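(* Let $G$ be a locally compact second countable abelian group and let $P_o\subset G$ be a uniformly discrete set with positive upper Banach density. Let $\Delta\subset G$ and suppose that $0\in\Delta$ and there is an open identity neighbourhood $W$ in $G$ such that $$(\overline{P_o-P_o}-\Delta)\cap W=\{0\}.$$ Then there exists an ergodic $\mu\in\mathrm{Prob}_G(\Omega_{P_o}^{\times})$ such that $$d^*(P_o)=\mu_{\mathcal{T}_{P_o}}(\mathcal{T}_{P_o})$$ and, for all $r\ge1$ and all $g_1,\ldots,g_r\in\Delta$, $$d^*\Big(P_o\cap\Big(\bigcap_{k=1}^r(P_o-g_k)\Big)\Big)\ \ge\ \mu_{\mathcal{T}_{P_o}}\Big(\bigcap_{k=1}^r(-g_k).\mathcal{T}_{P_o}\Big).$$
   Context: $G$ is written additively with identity $0$; topological groups are Hausdorff; $m_G$ is a fixed Haar measure; ''bounded'' means relatively compact. A set $P\subset G$ is $U$-uniformly discrete, for an identity neighbourhood $U$, if $(P-P)\cap U=\{0\}$, and uniformly discrete if this holds for some $U$ (the empty set is also allowed when computing densities). A strong F\o lner sequence in $G$ is a sequence $(F_n)$ of bounded Borel sets of positive Haar measure such that (i) $\lim_{n}\frac{m_G(F_n+C)}{m_G(F_n)}=1$ for every compact $C\subset G$; and (ii) there is an open bounded identity neighbourhood $V$ with $\lim_n\frac{m_G(\bigcap_{v\in V}(F_n-v))}{m_G(F_n)}=1$. For uniformly discrete $P$, the upper Banach density is $d^*(P)=\sup\{\varlimsup_{n}\frac{|P\cap F_n|}{m_G(F_n)} : (F_n)\text{ a strong F\o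 lner sequence in }G\}$ (so $d^*(\emptyset)=0$). Hulls: $\mathscr{C}(G)$ is the space of closed subsets of $G$ with the Chabauty topology, a compact metrizable space in which $P_n\to P$ iff (a) whenever $p_{n_k}\in P_{n_k}$ along a subsequence and $p_{n_k}\to p$ in $G$, then $p\in P$; and (b) every $p\in P$ is the limit of some $p_n\in P_n$. $G$ acts continuously by $g.P=P-g$. Set $\Omega_{P_o}=\overline{G.P_o}$ (the hull), $\Omega_{P_o}^\times=\Omega_{P_o}\setminus\{\emptyset\}$ (the punctured hull), and $\mathcal{T}_{P_o}=\{P\in\Omega_{P_o}^\times: 0\in P\}$ (the canonical cross-section). $\mathrm{Prob}_G(X)$ denotes the $G$-invariant Borel probability measures on $X$. Transverse measure: if $P_o$ is $U$-uniformly discrete with $U$ an open bounded identity neighbourhood, then $G.\mathcal{T}_{P_o}=\Omega_{P_o}^\times$ and $\{g\in G: g.\mathcal{T}_{P_o}\cap\mathcal{T}_{P_o}\neq\emptyset\}\cap U=\{0\}$; for every $\mu\in\mathrm{Prob}_G(\Omega_{P_o}^\times)$ there is a unique finite non-negative Borel measure $\mu_{\mathcal{T}_{P_o}}$ on $\mathcal{T}_{P_o}$ with $\mu(V.B)=m_G(V)\,\mu_{\mathcal{T}_{P_o}}(B)$ for all Borel $V\subset G$ with $V-V\subset U$ and all Borel $B\subset\mathcal{T}_{P_o}$ (it does not depend on the choice of such $U$). It is regarded as a measure on $\Omega_{P_o}^\times$ via $\mu_{\mathcal{T}_{P_o}}(A)=\mu_{\mathcal{T}_{P_o}}(A\cap\mathcal{T}_{P_o})$.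 *)

(* Defs.v *)
From HB Require Import structures.
From mathcomp Require Import all_boot all_order all_algebra.
From mathcomp Require Import all_classical all_reals all_analysis.

Set Implicit Arguments.
Unset Strict Implicit.
Unset Printing Implicit Defensive.
Import Order.TTheory GRing.Theory Num.Theory.
Import numFieldTopology.Exports.

Local Open Scope classical_set_scope.
Local Open Scope ring_scope.

HB.instance Definition _ (G : topologicalZmodType) := isPointed.Build G 0.

(* T, seen as a measurable space with its Borel sigma-algebra. *)
Notation borel T := (g_sigma_algebraType (@open T)).

Section MinkowskiOperations.
Context {G : zmodType}.
Implicit Types (A B P : set G) (g : G).

Definition setadd A B : set G := [set a + b | a in A & b in B].

Definition setsub A B : set G := [set a - b | a in A & b in B].

Definition translate P g : set G := [set p - g | p in P].

End MinkowskiOperations.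

(* topologicalZmodType includes no separation axiom. *)
Definition lcsc (G : topologicalType) : Prop :=
  [/\ hausdorff_space G, locally_compact [set: G] & @second_countable G].

Section HaarMeasure.
Context {R : realType} {G : topologicalZmodType}.
Local Open Scope ereal_scope.

(* Regularity is not required: it is automatic for a Borel measure that is
   finite on compact sets when G is locally compact and second countable. *)
Definition haar_measure (m : {measure set (borel G) -> \bar R}) : Prop :=
  [/\ forall K : set G, compact K -> m K < +oo,
      forall U : set G, open U -> U !=set0 -> 0 < m U &
      forall (g : G) (A : set (borel G)), measurable A ->
        m (translate A g) = m A].

End HaarMeasure.

Section UniformlyDiscrete.
Context {G : topologicalZmodType}.

Definition unif_discrete_for (U P : set G) : Prop :=
  setsub P P `&` U = [set 0].

Definition unif_discrete (P : set G) : Prop :=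
  exists2 U, nbhs 0 U & unif_discrete_for U P.

Lemma unif_discrete_closed (P : set G) :
  hausdorff_space G -> unif_discrete P -> closed P.
Proof.
move=> hG [U nU hU] x clx.
have hd p q : P p -> P q -> U (p - q) -> p = q.
  move=> Pp Pq Upq; apply/eqP; rewrite -subr_eq0; apply/eqP.
  have : [set 0] (p - q) by rewrite -hU; split=> //; exists p => //; exists q.
  by [].
have c1 : (fun y : G * G => y.1 - y.2) @ nbhs (x, x) --> nbhs (0 : G).
  rewrite -(subrr x); exact: (@sub_continuous G (x, x)).
have [[A B] /= [nA nB] AB] := c1 _ nU.
have nAB : nbhs x (A `&` B) by exact: filterI.
have [p [Pp [Ap Bp]]] := clx _ nAB.
suff <- : p = x by [].
apply: hG => C D nC nD.
have nABD : nbhs x (A `&` B `&` D) by exact: filterI.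
have [q [Pq [[Aq Bq] Dq]]] := clx _ nABD.
have qp : q = p by apply: hd => //; exact: (AB (q, p)).
exists p; split; last by rewrite -qp.
exact: nbhs_singleton.
Qed.

End UniformlyDiscrete.

Section UpperBanachDensity.
Context {R : realType} {G : topologicalZmodType}.
Variable m : {measure set (borel G) -> \bar R}.
Local Open Scope ereal_scope.

(* - For F Borel and C compact, F + C is analytic but not Borel in general, so
     its Haar measure is that of the completion of m, which coincides with the
     outer measure mu_ext m.
   - C = set0 has to be left out, since then F + C = set0. *)
Definition strong_folner (F : nat -> set (borel G)) : Prop :=
  [/\ forall n, [/\ precompact (F n : set G), measurable (F n) & 0 < m (F n)],
      forall C : set G, compact C -> C !=set0 ->
        mu_ext m (setadd (F n) C) / m (F n) @[n --> \oo] --> 1 &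
      exists V : set G, [/\ open V, precompact V, V 0%R &
        m (\bigcap_(v in V) translate (F n) v) / m (F n) @[n --> \oo] --> 1]].

Definition upper_Banach_density (P : set G) : \bar R :=
  ereal_sup [set limn_esup (fun n => counting (P `&` F n) / m (F n))
            | F in strong_folner].

End UpperBanachDensity.

Record closedSet (G : topologicalType) := ClosedSet {
  closed_set :> set G ;
  closed_setP : closed closed_set }.

HB.instance Definition _ G := gen_eqMixin (closedSet G).
HB.instance Definition _ G := gen_choiceMixin (closedSet G).
HB.instance Definition _ (G : topologicalType) :=
  isPointed.Build (closedSet G) (ClosedSet closed0).

(* The Chabauty(-Fell) topology. *)
Definition chabauty_subbase (G : topologicalType) : set (set (closedSet G)) :=
  [set [set P : closedSet G | P `&` K = set0] | K in compact] `|`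
  [set [set P : closedSet G | P `&` U !=set0] | U in open].

HB.instance Definition _ (G : topologicalType) :=
  isSubBaseTopological.Build (closedSet G) (@chabauty_subbase G) id.

Section Action.
Context {G : topologicalZmodType}.

Lemma closed_translate (P : set G) (g : G) : closed P -> closed (translate P g).
Proof.
move=> cP; suff -> : translate P g = (fun x => x + g) @^-1` P.
  by apply: preimage_closed => // x _; apply: (@continuous_comp _ _ _
    (fun y => (y, g)) (fun y : G * G => y.1 + y.2));
    [apply: cvg_pair; [exact: cvg_id|exact: cvg_cst]|exact: add_continuous].
apply/seteqP; split=> [_ [p Pp <-]|x Px] /=; first by rewrite subrK.
by exists (x + g) => //; rewrite addrK.
Qed.

Definition closed_act (g : G) (P : closedSet G) : closedSet G :=
  ClosedSet (@closed_translate P g (@closed_setP _ P)).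

End Action.

Section Hull.
Context {G : topologicalZmodType}.
Variable Po : set G.

(* This is empty if Po is not closed, which unif_discrete_closed excludes. *)
Definition hull_orbit : set (closedSet G) :=
  [set Q : closedSet G | exists g : G, Q = translate Po g :> set G].

Definition hull : set (closedSet G) := closure hull_orbit.

Definition punctured_hull : set (closedSet G) :=
  hull `\` [set P : closedSet G | P = set0 :> set G].

Definition cross_section : set (closedSet G) :=
  punctured_hull `&` [set P : closedSet G | closed_set P 0].

End Hull.

Section InvariantMeasures.
Context {R : realType} {G : topologicalZmodType}.
Local Open Scope ereal_scope.

(* An element of Prob_G(X), for X an invariant Borel set of closed subsets of
   G, is given as a Borel probability measure on the space of all closed
   subsets of G for which X has full measure. *)
Definition invariant_probability_on (X : set (closedSet G))
    (mu : probability (borel (closedSet G)) R) : Prop :=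
  mu X = 1 /\
  forall (g : G) (A : set (borel (closedSet G))), measurable A ->
    mu (closed_act g @` A) = mu A.

Definition ergodic_on (X : set (closedSet G))
    (mu : probability (borel (closedSet G)) R) : Prop :=
  forall A : set (borel (closedSet G)), measurable A -> A `<=` X ->
    (forall g : G, closed_act g @` A = A) -> mu A = 0 \/ mu A = 1.

(* nu is the transverse measure of mu, regarded as a measure on the space of
   all closed subsets of G by nu A = nu (A `&` cross_section Po); these
   conditions determine nu on the Borel sets if Po is uniformly discrete and G
   is locally compact. *)
Definition is_transverse_measure (m : {measure set (borel G) -> \bar R})
    (Po : set G) (mu : probability (borel (closedSet G)) R)
    (nu : {finite_measure set (borel (closedSet G)) -> \bar R}) : Prop :=
  (forall A : set (borel (closedSet G)), measurable A ->
     nu A = nu (A `&` cross_section Po)) /\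
  forall U : set G, open U -> precompact U -> U 0%R ->
    unif_discrete_for U Po ->
    forall (V : set (borel G)) (B : set (borel (closedSet G))),
      measurable V -> setsub V V `<=` U ->
      measurable B -> B `<=` cross_section Po ->
      mu [set closed_act v P | v in (V : set G) & P in B] = m V * nu B.

End InvariantMeasures.

(* Main.v *)
(* Write T for the cross-section and V.B for the sweep of B by a small set V.
   The Borel probability measures invariant under the action are compared with
   densities in two directions.

   Along an ultrafilter, the empirical measures of the orbit of Po on a strong
   Folner sequence (F_n) converge on all Borel sets to a finitely additive
   invariant probability on the hull. Its regularization is a genuine invariant
   Borel probability mu, which can only increase on closed sets; as V.T is closed
   for V compact, mu(V.T) is at least m(V) times the density of Po along (F_n).

   Conversely, let B be the set of Q in T that contain g_1, ..., g_r. By Fubini,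
   for every invariant mu and every n some Q in the hull visits V.B along F_n
   with frequency at least about mu(V.B). So Q contains about
   m(F_n) mu(V.B) / m(V) occurrences of the pattern (0, g_1, ..., g_r) near F_n,
   and, by the assumption on Delta, so does some translate of Po. A translate of
   the thickening F_n + O by a bounded open set O thus witnesses
   mu(V.B) <= m(V) d*(pattern); no ergodic theorem is needed, and thickening by
   an open set makes the second Folner condition a consequence of the first.

   With r = 0 the second estimate shows that the invariant measures with
   mu(V.T) = m(V) d*(Po) are those of maximal transverse mass. Among them, a
   strictly convex functional, upper semicontinuous because it is built from the
   masses of closed sets, attains its maximum at a measure that is not a proper
   convex combination of invariant measures, hence is ergodic. *)

Require Import Defs.
From HB Require Import structures.
From mathcomp Require Import all_boot all_order all_algebra finmap.
From mathcomp Require Import all_classical all_reals all_analysis measurable_realfun.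
From mathcomp Require Import ring lra.

Set Implicit Arguments.
Unset Strict Implicit.
Unset Printing Implicit Defensive.
Import Order.TTheory GRing.Theory Num.Theory.
Import numFieldTopology.Exports.

Local Open Scope classical_set_scope.
Local Open Scope ring_scope.

(** * Chabauty topology *)

Lemma countable_setU (T : Type) (A B : set T) :
  countable A -> countable B -> countable (A `|` B).
Proof.
move=> cA cB; rewrite -bigcup2E; apply: bigcup_countable => // -[|[|n]] _ //=.
Qed.

Section ChabautyTopology.
Context {T : topologicalType}.
Implicit Types (x y : T) (K U : set T) (P Q : closedSet T).

Definition avoiding K : set (closedSet T) := [set P | P `&` K = set0].
Definition hitting U : set (closedSet T) := [set P | P `&` U !=set0].

Lemma open_chabauty_subbase : @chabauty_subbase T `<=` open.
Proof.
move=> A DA; exists [set A]; last by rewrite bigcup_set1.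
by move=> _ ->; exact: finI_from1.
Qed.

Lemma open_avoiding K : compact K -> open (avoiding K).
Proof. by move=> cK; apply: open_chabauty_subbase; left; exists K. Qed.

Lemma open_hitting U : open U -> open (hitting U).
Proof. by move=> oU; apply: open_chabauty_subbase; right; exists U. Qed.

Lemma notin_avoiding K P : ~ avoiding K P <-> exists2 x, closed_set P x & K x.
Proof.
split=> [nPK|[x Px Kx] PK]; last by have : set0 x by rewrite -PK.
have /set0P[x [Px Kx]] : P `&` K != set0 by apply/eqP.
by exists x.
Qed.

(** A neighbourhood of [P] contains a finite intersection of subbasic sets around [P], so it
    suffices to test the two kinds of subbasic sets. *)
Lemma cvg_chabauty (F : set_system (closedSet T)) P : Filter F ->
  (forall K, compact K -> avoiding K P -> F (avoiding K)) ->
  (forall U, open U -> hitting U P -> F (hitting U)) ->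
  F --> P.
Proof.
move=> FF Fav Fhit A; rewrite /= nbhsE => -[B [[D sD <-] [C DC CP]] BA].
apply: filterS BA _; apply: (@filterS _ _ _ C); first by move=> Q ?; exists C.
have /sD[E sE ECE] := DC; move: CP; rewrite -ECE => CP.
apply: filter_bigI => W WE; have := sE _ WE; rewrite inE.
by move: (CP _ WE) => /[swap] -[[K cK <-]|[U oU <-]] ?; [exact: Fav|exact: Fhit].
Qed.

(** Compactness of [K] turns local data, a neighbourhood and a member of [F] for each point of [K],
    into a single member of [F]. *)
Lemma near_avoiding K (F : set_system (closedSet T)) : compact K -> Filter F ->
  (forall x, K x -> \forall y \near x & Q \near F, ~ closed_set Q y) ->
  F (avoiding K).
Proof.
move=> /compact_near_coveringP cK FF H.
apply: filterS (cK _ F (fun Q x => ~ closed_set Q x) FF H) => Q KQ.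
by rewrite /avoiding /= -subset0 => x [Qx /KQ].
Qed.

(** Every ultrafilter converges: its limit is the set [L] of the points all of whose open
    neighbourhoods are hit by [F]-almost every closed set. *)
Lemma compact_closedSet : compact [set: closedSet T].
Proof.
rewrite compact_ultra => F FU _.
pose L : set T := [set x | forall U, open U -> U x -> F (hitting U)].
have cL : closed L.
  move=> x clx U oU Ux.
  have [y [Ly Uy]] := clx _ (open_nbhs_nbhs (conj oU Ux)).
  exact: Ly.
exists (ClosedSet cL); split=> //; apply: cvg_chabauty.
- move=> K cK LK.
  apply: near_avoiding => // x Kx.
  have : ~ L x by move=> Lx; have : set0 x by rewrite -LK.
  move=> /existsNP[U /not_implyP[oU /not_implyP[Ux nF]]].
  (* An ultrafilter not containing [hitting U] contains its complement, so the neighbourhood [U] of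
     [x] is missed along [F]. *)
  have [//|FnU] := in_ultra_setVsetC (hitting U) FU.
  exists (U, ~` hitting U); first by split=> //; exact: open_nbhs_nbhs.
  by move=> [y Q] /= [Uy nQU] Qy; apply: nQU; exists y.
- by move=> U oU [x [Lx Ux]]; exact: Lx.
Qed.

Hypotheses (hT : hausdorff_space T) (lT : locally_compact [set: T]).

Lemma locally_compact_nbhs x U : nbhs x U ->
  exists N, [/\ nbhs x N, compact N, closed N & N `<=` U].
Proof.
move=> nU; have [V] := lT (x := x) I; rewrite withinET => nV [cV clV].
have [W] := @compact_regular _ x V hT cV nV U nU.
move=> nW WU; exists (closure W `&` V); split.
- by apply: filterI => //; apply: filterS nW; exact: subset_closure.
- by rewrite setIC; apply: compact_closedI => //; exact: closed_closure.
- by apply: closedI => //; exact: closed_closure.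
- by move=> y [/WU].
Qed.

Lemma avoiding_nbhs P x : ~ closed_set P x ->
  exists N, [/\ nbhs x N, compact N, closed N & avoiding N P].
Proof.
move=> nPx; have [|N [nN cN clN NP]] := @locally_compact_nbhs x (~` P).
  by apply: open_nbhs_nbhs; split=> //; exact/closed_openC/closed_setP.
by exists N; split=> //; rewrite /avoiding /= -subset0 => y [Py /NP].
Qed.

Lemma near_notin P x : ~ closed_set P x -> \forall y \near x & Q \near P, ~ closed_set Q y.
Proof.
move=> /avoiding_nbhs[N [nN cN _ NP]]; exists (N, avoiding N).
  by split=> //; apply: open_nbhs_nbhs; split=> //; exact: open_avoiding.
by move=> [y Q] /= [Ny QN] Qy; have : set0 y by rewrite -QN.
Qed.

Lemma closedSet_ext P Q : (forall x, closed_set P x <-> closed_set Q x) -> P = Q.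
Proof.
case: P Q => [P cP] [Q cQ] /= PQ.
have {}PQ : P = Q by apply/seteqP; split=> x /PQ.
by subst Q; congr ClosedSet; exact: Prop_irrelevance.
Qed.

(** A point of one set outside the other has a compact neighbourhood [N] missing the other; hitting
    the interior of [N] and avoiding [N] are disjoint open conditions that separate the two sets. *)
Lemma hausdorff_closedSet : hausdorff_space (closedSet T).
Proof.
suff H P Q : cluster (nbhs P) Q -> forall x, closed_set P x -> closed_set Q x.
  move=> P Q PQ; apply: closedSet_ext => x; split; apply: H => //.
  by move=> A B nA nB; have [y []] := PQ _ _ nB nA; exists y.
move=> PQ x Px; apply: contrapT => /avoiding_nbhs[N [nN cN _ QN]].
have [] := PQ (hitting N°) (avoiding N).
- apply: open_nbhs_nbhs; split; first by apply: open_hitting; exact: open_interior.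
  by exists x; split.
- by apply: open_nbhs_nbhs; split => //; exact: open_avoiding.
- move=> R [[y [Ry /interior_subset Ny]] RN].
  by have : set0 y by rewrite -RN.
Qed.

(** A countable subbase consists of hitting a basic open set and of avoiding the closure of a basic
    open set when that closure is compact. Local compactness provides enough of these closures to
    cover any compact set missed by [P]. *)
Lemma second_countable_closedSet :
  @second_countable T -> @second_countable (closedSet T).
Proof.
move=> [B cB [oB Bx]].
pose D : set (set (closedSet T)) := [set hitting b | b in B] `|`
  [set avoiding (closure b) | b in [set b | B b /\ compact (closure b)]].
have sD : D `<=` open.
  move=> _ [[b Bb <-]|[b [Bb cb] <-]]; last exact: open_avoiding.
  exact/open_hitting/oB.
have sDO : finI_from D id `<=` open.
  move=> _ [E sE <-]; rewrite bigcap_fset big_seq; apply: big_ind => //.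
  - exact: openT.
  - exact: openI.
  - by move=> i /sE; rewrite inE => /sD.
exists (finI_from D id).
  apply: finI_from_countable; rewrite /D; apply: countable_setU.
    exact: sub_countable (card_image_le _ _) cB.
  apply: sub_countable (card_image_le _ _) _.
  by apply: sub_countable cB; apply: subset_card_le => b [].
split=> // P; have FF : Filter
    (filter_from [set U | finI_from D id U /\ U P] id).
  apply: filter_from_filter; first by exists setT; split=> //; exists fset0 => //;
    rewrite predeqE.
  move=> U V [DU UP] [DV VP]; exists (U `&` V) => //; split=> //.
  exact: finI_fromI.
apply: cvg_chabauty.
- move=> K cK PK.
  apply: near_avoiding => // x Kx.
  have /avoiding_nbhs[N [nN cN clN PN]] : ~ closed_set P x.
    by move=> Px; have : set0 x by rewrite -PK.
  have [b [Bb bx] /= bN] := Bx x _ nN.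
  have clbN : closure b `<=` N by rewrite [N](closure_id _).1//; exact: closureS.
  exists (b, avoiding (closure b)).
    split; first by apply: open_nbhs_nbhs; split => //; exact: oB.
    exists (avoiding (closure b)) => //; split.
      apply: finI_from1; right; exists b => //; split=> //.
      exact: subclosed_compact (@closed_closure _ _) cN clbN.
    by rewrite /avoiding /= -subset0 => y [Py /clbN Ny]; have : set0 y by rewrite -PN.
  by move=> [y Q] /= [/subset_closure by_ Qb] Qy; have : set0 y by rewrite -Qb.
- move=> U oU [x [Px Ux]].
  have [b [Bb bx] /= bU] := Bx x _ (open_nbhs_nbhs (conj oU Ux)).
  exists (hitting b); last by move=> Q [y [Qy /bU Uy]]; exists y.
  by split; [apply: finI_from1; left; exists b|exists x].
Qed.

End ChabautyTopology.

Lemma continuous_pairl (S T : topologicalType) (a : S) :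
  continuous (fun y : T => (a, y)).
Proof.
move=> y A [[B C] /= [nB nC] BC]; apply: filterS nC => z Cz.
by apply: (BC (a, z)); split=> //=; exact: nbhs_singleton.
Qed.

Lemma continuous_pairr (S T : topologicalType) (b : T) :
  continuous (fun x : S => (x, b)).
Proof.
move=> x A [[B C] /= [nB nC] BC]; apply: filterS nB => z Bz.
by apply: (BC (z, b)); split=> //=; exact: nbhs_singleton.
Qed.

(** * Minkowski sums and uniform discreteness in topological groups *)

Section GroupTopology.
Context {G : topologicalZmodType}.
Implicit Types (x g h : G) (A B C K U P : set G).

Lemma translateE P g x : translate P g x <-> P (x + g).
Proof.
split=> [[p Pp <-]|Px]; first by rewrite subrK.
by exists (x + g) => //; rewrite addrK.
Qed.

Lemma translate_preimage P g : translate P g = (fun x => x + g) @^-1` P.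
Proof. by apply/seteqP; split=> x /translateE. Qed.

Lemma addl_continuous g : continuous (fun x : G => x + g).
Proof.
move=> x; apply: (@continuous_comp _ _ _ (fun y => (y, g))
  (fun y : G * G => y.1 + y.2)); first exact: continuous_pairr.
exact: add_continuous.
Qed.

Lemma open_translate U g : open U -> open (translate U g).
Proof.
rewrite translate_preimage => oU; apply: open_comp => // x _.
exact: addl_continuous.
Qed.

Lemma nbhs_add x y (U : set G) : nbhs (x + y) U ->
  exists A B, [/\ nbhs x A, nbhs y B & forall a b, A a -> B b -> U (a + b)].
Proof.
move=> nU; have [[A B] /= [nA nB] AB] := @add_continuous G (x, y) _ nU.
by exists A, B; split=> // a b Aa Bb; exact: (AB (a, b)).
Qed.

Lemma nbhs_sub x y (U : set G) : nbhs (x - y) U ->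
  exists A B, [/\ nbhs x A, nbhs y B & forall a b, A a -> B b -> U (a - b)].
Proof.
move=> nU; have [[A B] /= [nA nB] AB] := @sub_continuous G (x, y) _ nU.
by exists A, B; split=> // a b Aa Bb; exact: (AB (a, b)).
Qed.

Lemma nbhs_sub0 (U : set G) : nbhs (0 : G) U ->
  exists A, [/\ open A, A 0 & setsub A A `<=` U].
Proof.
move=> nU; have : nbhs (0 - 0) U by rewrite subr0.
move=> /nbhs_sub[A [B [nA nB AB]]].
exists (A `&` B)°; split; [exact: open_interior|exact: (filterI nA nB)|].
by move=> _ [a /interior_subset[Aa _] [b /interior_subset[_ Bb] <-]]; exact: AB.
Qed.

Lemma open_setadd A B : open B -> open (setadd A B).
Proof.
move=> oB; suff -> : setadd A B = \bigcup_(a in A) translate B (- a).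
  by apply: bigcup_open => a _; exact: open_translate.
apply/seteqP; split=> [_ [a Aa [b Bb <-]]|x [a Aa /translateE Bx]].
  by exists a => //; apply/translateE; rewrite addrC addKr.
by exists a => //; exists (x - a) => //; rewrite addrC subrK.
Qed.

Lemma compact_setadd A B : compact A -> compact B -> compact (setadd A B).
Proof.
move=> cA cB; have -> : setadd A B = (fun z : G * G => z.1 + z.2) @` (A `*` B).
  apply/seteqP; split=> [_ [a Aa [b Bb <-]]|_ [[a b] [Aa Bb] <-]].
    by exists (a, b).
  by exists a => //; exists b.
apply: continuous_compact; last exact: compact_setX.
exact/continuous_subspaceT/add_continuous.
Qed.

Lemma compact_opp A : compact A -> compact (-%R @` A).
Proof.
move=> cA; apply: continuous_compact => //.
exact/continuous_subspaceT/opp_continuous.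
Qed.

Lemma precompact_setadd A B : hausdorff_space G ->
  precompact A -> precompact B -> precompact (setadd A B).
Proof.
move=> hG; rewrite (precompactE A) (precompactE B) => cA cB.
apply: (@precompact_subset _ _ (setadd (closure A) (closure B))); last first.
  by apply: compact_precompact => //; exact: compact_setadd.
move=> _ [a Aa [b Bb <-]]; exists a; first exact: subset_closure.
by exists b => //; exact: subset_closure.
Qed.

Lemma precompact_setsub A B : hausdorff_space G ->
  precompact A -> precompact B -> precompact (setsub A B).
Proof.
move=> hG pA; rewrite precompactE => cB.
apply: (@precompact_subset _ _ (setadd A (-%R @` closure B))).
  move=> _ [a Aa [b Bb <-]]; exists a => //; exists (- b) => //.
  by exists b => //; exact: subset_closure.
by apply: precompact_setadd => //; apply: compact_precompact => //; exact: compact_opp.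
Qed.

Lemma unif_discrete_for_inj U P p q :
  unif_discrete_for U P -> P p -> P q -> U (p - q) -> p = q.
Proof.
move=> UP Pp Pq Upq; apply/eqP; rewrite -subr_eq0; apply/eqP.
by have : [set 0] (p - q) by rewrite -UP; split=> //; exists p => //; exists q.
Qed.

(** Unlike [unif_discrete_for], which forces [0] to be a difference of points of [P], this form
    holds for the empty set; it passes to subsets and to every member of the hull. *)
Definition unif_separated U P := forall p q, P p -> P q -> U (p - q) -> p = q.

(** The closure of [A] is covered by finitely many translates of a set [B] with [B - B] inside [U],
    and each of these contains at most one point of [P]. *)
Lemma finite_separated U P A : nbhs (0 : G) U -> unif_separated U P ->
  precompact A -> finite_set (P `&` A).
Proof.
move=> nU UP; rewrite precompactE => cA.
have [B [oB B0 BU]] := nbhs_sub0 nU.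
move: cA; rewrite compact_cover => /(_ G setT (fun x => translate B (- x))).
case=> [x _|x Ax|D _ AD]; first exact: open_translate.
  by exists x => //; apply/translateE; rewrite subrr.
pose f x := xget 0 (P `&` translate B (- x)).
apply: (@sub_finite_set _ _ (f @` [set` D])); last first.
  by apply: finite_image; exact: finite_fset.
move=> p [Pp /subset_closure/AD[x Dx Bpx]]; exists x => //.
have [Pf /translateE Bf] : (P `&` translate B (- x)) (f x).
  by apply: xgetPex; exists p.
apply: UP => //; apply: BU; exists (f x - x) => //; exists (p - x).
  exact/translateE.
by rewrite opprB addrA subrK.
Qed.

End GroupTopology.

(** * The action on closed sets and the hull *)

Section HullAction.
Context {G : topologicalZmodType}.
Implicit Types (g h x : G) (U : set G) (P Q : closedSet G) (A : set (closedSet G)).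

Lemma closed_actE g P x : closed_set (closed_act g P) x <-> closed_set P (x + g).
Proof. exact: translateE. Qed.

Lemma closed_act0 P : closed_act 0 P = P.
Proof. by apply: closedSet_ext => x; rewrite closed_actE addr0. Qed.

Lemma closed_actD g h P : closed_act g (closed_act h P) = closed_act (g + h) P.
Proof. by apply: closedSet_ext => x; rewrite !closed_actE addrA. Qed.

Lemma closed_actK g P : closed_act (- g) (closed_act g P) = P.
Proof. by rewrite closed_actD addNr closed_act0. Qed.

Lemma closed_actNK g P : closed_act g (closed_act (- g) P) = P.
Proof. by rewrite closed_actD subrr closed_act0. Qed.

Lemma closed_act_image g A : closed_act g @` A = closed_act (- g) @^-1` A.
Proof.
apply/seteqP; split=> [_ [P AP <-]|P AP] /=; first by rewrite closed_actK.
by exists (closed_act (- g) P) => //; rewrite closed_actNK.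
Qed.

Section continuity.
Hypotheses (hG : hausdorff_space G) (lG : locally_compact [set: G]).

(** Avoiding a compact set is stable because non-membership is an open condition on pairs
    ([near_notin]), made uniform by compactness; a hit survives because the point of the hit moves
    continuously with the shift. *)
Lemma closed_act_continuous :
  continuous (fun z : G * closedSet G => closed_act z.1 z.2).
Proof.
move=> [g P]; apply: cvg_chabauty => /= [K cK KP|U oU [x [/closed_actE Px Ux]]].
  have near_act : forall x, K x ->
      \forall y \near x & z \near (g, P), ~ closed_set (closed_act z.1 z.2) y.
    move=> x Kx; have : ~ closed_set P (x + g).
      by move=> /closed_actE Px; have : set0 x by rewrite -KP.
    move=> /(near_notin hG lG)[[A B] /= [nA nB] AB].
    have [C [D [nC nD CD]]] := nbhs_add nA.
    exists (C, D `*` B); first by split=> //; exists (D, B).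
    move=> [y [h Q]] /= [Cy [Dh BQ]] /closed_actE Qy.
    by apply: (AB (y + h, Q)) => //; split=> //=; exact: CD.
  have FF : Filter (nbhs (g, P)) by exact: nbhs_filter.
  have nearK := (compact_near_coveringP K).1 cK _ (nbhs (g, P))
    (fun z y => ~ closed_set (closed_act z.1 z.2) y) FF near_act.
  apply: (@filterS _ _ FF) nearK => z Kz; rewrite /= /avoiding /= -subset0 => y [zy /Kz].
  exact.
have : nbhs ((x + g) - g) U by rewrite addrK; exact: open_nbhs_nbhs.
move=> /nbhs_sub[A [B [nA nB AB]]].
exists (B, hitting A°).
  split=> //=; apply: open_nbhs_nbhs; split.
    by apply: open_hitting; exact: open_interior.
  by exists (x + g); split=> //; exact: nbhs_interior.
move=> [h Q] /= [Bh [y [Qy /interior_subset Ay]]]; exists (y - h); split.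
  by apply/closed_actE; rewrite subrK.
exact: AB.
Qed.

Lemma closed_act_continuousr g : continuous (closed_act g).
Proof.
move=> P; apply: (@continuous_comp _ _ _ (fun P => (g, P))
  (fun z : G * closedSet G => closed_act z.1 z.2)).
  exact: continuous_pairl.
exact: closed_act_continuous.
Qed.

Lemma closed_act_continuousl P : continuous (closed_act ^~ P).
Proof.
move=> g; apply: (@continuous_comp _ _ _ (fun g => (g, P))
  (fun z : G * closedSet G => closed_act z.1 z.2)).
  exact: continuous_pairr.
exact: closed_act_continuous.
Qed.

Lemma hull_act (Po : set G) g P : hull Po P -> hull Po (closed_act g P).
Proof.
move=> hP A /(closed_act_continuousr (x := P)) /hP[Q [[h Qh] AQ]].
exists (closed_act g Q); split=> //; exists (g + h).
apply/seteqP; split=> x; rewrite closed_actE Qh !translateE addrA //.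
Qed.

End continuity.

Lemma closed_hull (Po : set G) : closed (hull Po).
Proof. exact: closed_closure. Qed.

(** If [p] and [q] had disjoint neighbourhoods, a translate of [Po] close to [P] would have points
    near [p] and near [q] that are distinct but, as [U] is open, still differ by an element of
    [U]. *)
Lemma hull_separated (hG : hausdorff_space G) (Po : set G) U P : open U ->
  unif_separated U Po -> hull Po P -> unif_separated U P.
Proof.
move=> oU UPo hP p q Pp Pq Upq; apply: hG => A B nA nB.
have [C [D [nC nD CD]]] := nbhs_sub (open_nbhs_nbhs (conj oU Upq)).
have nAC : nbhs p (A `&` C) by exact: filterI.
have nBD : nbhs q (B `&` D) by exact: filterI.
have [|Q [[h Qh] [[x [Qx /interior_subset[Ax Cx]]] [y [Qy /interior_subset[By Dy]]]]]] :=
    hP (hitting (A `&` C)° `&` hitting (B `&` D)°).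
  apply: filterI; apply: open_nbhs_nbhs; split; try exact/open_hitting/open_interior.
  - by exists p; split=> //; exact: nbhs_interior.
  - by exists q; split=> //; exact: nbhs_interior.
suff xy : x = y by exists x; split=> //; rewrite xy.
move: Qx Qy; rewrite Qh => -[a Pa ax] [b Pb b_y].
rewrite -ax -b_y; congr (_ - _); apply: UPo => //.
have -> : a - b = x - y by rewrite -ax -b_y opprB addrA subrK.
exact: CD.
Qed.

End HullAction.

(** * Regularization of finitely additive measures *)

Section BorelSets.
Context {X : ptopologicalType}.
Implicit Types A : set X.

Lemma measurable_open A : open A -> measurable (A : set (borel X)).
Proof. exact: sub_sigma_algebra. Qed.

Lemma measurable_closed A : closed A -> measurable (A : set (borel X)).
Proof.
by move=> cA; rewrite -[A]setCK; apply: measurableC; apply: measurable_open; exact: closed_openC.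
Qed.

End BorelSets.

Lemma measurable_continuous (X Y : ptopologicalType) (f : X -> Y) :
  continuous f -> @measurable_fun _ _ (borel X) (borel Y) setT f.
Proof.
move=> cf; apply: (@measurability _ _ (borel X) (borel Y) setT f (@open Y)) => //.
move=> _ [B oB <-]; rewrite setTI; apply: measurable_open.
by apply: open_comp => // x _; exact: cf.
Qed.

Lemma measurable_preimage (X Y : ptopologicalType) (f : X -> Y) (A : set Y) :
  continuous f -> measurable (A : set (borel Y)) ->
  measurable (f @^-1` A : set (borel X)).
Proof.
move=> cf mA; rewrite -[_ @^-1` _]setTI.
exact: (measurable_continuous cf (@measurableT _ (borel X)) mA).
Qed.

(** Real values let these axioms pass to limits along an ultrafilter, which countable additivity
    need not survive. *)
Definition finitely_additive_probability (R : realType) d (T : measurableType d)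
    (lam : set T -> R) :=
  [/\ forall A, measurable A -> 0 <= lam A, lam setT = 1 &
      forall A B, measurable A -> measurable B -> A `&` B = set0 ->
        lam (A `|` B) = lam A + lam B].

Section FinitelyAdditive.
Context {R : realType} d {T : measurableType d} (lam : set T -> R).
Hypothesis fa : finitely_additive_probability lam.

Lemma fa_le A B : measurable A -> measurable B -> A `<=` B -> lam A <= lam B.
Proof.
case: fa => lam0 _ lamU mA mB AB; rewrite -(setDUK AB) lamU ?setDIK//.
  by rewrite lerDl; apply: lam0; exact: measurableD.
exact: measurableD.
Qed.

Lemma fa_set0 : lam set0 = 0.
Proof.
case: fa => _ _ lamU; have := lamU set0 set0 measurable0 measurable0 (setI0 _).
by rewrite setU0 => /eqP; rewrite -subr_eq0 opprD addrA subrr sub0r oppr_eq0 => /eqP.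
Qed.

Lemma fa_leU A B : measurable A -> measurable B -> lam (A `|` B) <= lam A + lam B.
Proof.
case: fa => _ _ lamU mA mB.
have -> : A `|` B = A `|` (B `\` A) by rewrite setUDr setDv setD0.
rewrite lamU ?setDIK ?lerD2l//; last exact: measurableD.
by apply: fa_le => //; exact: measurableD.
Qed.

End FinitelyAdditive.

Section Regularization.
Context {R : realType} {X : ptopologicalType} (lam : set (borel X) -> R).
Hypotheses (hX : hausdorff_space X) (cX : compact [set: X]).
Hypothesis fa : finitely_additive_probability lam.
Local Open Scope ereal_scope.
Implicit Types A B O K : set X.

(** Inner approximation by closed sets, followed in [regularize] by outer approximation by open
    sets: the usual passage from a content to a regular Borel measure, as in the Riesz
    representation theorem. *)
Definition closed_inner O : \bar R :=
  ereal_sup [set (lam K)%:E | K in [set K : set X | closed K /\ K `<=` O]].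

Definition regularize A : \bar R :=
  ereal_inf [set closed_inner O | O in [set O : set X | open O /\ A `<=` O]].

Lemma closed_inner_ge O K : closed K -> K `<=` O -> (lam K)%:E <= closed_inner O.
Proof. by move=> cK KO; apply: ereal_sup_ubound; exists K. Qed.

Lemma closed_inner_ge0 O : 0 <= closed_inner O.
Proof.
by have := @closed_inner_ge O set0 closed0; rewrite (fa_set0 fa); exact.
Qed.

Lemma closed_inner_mono A B : A `<=` B -> closed_inner A <= closed_inner B.
Proof.
move=> AB; apply: ereal_sup_le => _ [K [cK KA] <-]; exists K => //.
by split=> //; exact: subset_trans AB.
Qed.

Lemma closed_inner_le1 O : closed_inner O <= 1.
Proof.
apply: ge_ereal_sup => _ [K [cK _] <-]; case: (fa) => _ <- _; rewrite lee_fin.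
by apply: (fa_le fa) => //; exact: measurable_closed.
Qed.

(** By induction, [K] is cut into two closed pieces, one inside the union of the first [N] sets and
    one inside [O N]. *)
Lemma closed_inner_sumU (O : (set X)^nat) N K : (forall n, open (O n)) ->
  closed K -> K `<=` \big[setU/set0]_(n < N) O n ->
  (lam K)%:E <= \sum_(n < N) closed_inner (O n).
Proof.
move=> oO; elim: N K => [|N IH] K cK.
  by rewrite !big_ord0 subset0 => ->; rewrite (fa_set0 fa).
rewrite !big_ord_recr /=; set A := \big[_/_]_(_ < _) _ => KAO.
have oA : open A.
  by rewrite /A; elim/big_ind : _ => //; [exact: open0|exact: openU].
have cD : closed (K `\` O N).
  by rewrite setDE; apply: closedI => //; exact: open_closedC.
have DA : K `\` O N `<=` A by move=> x [/KAO[]].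
(* Normality: the part of [K] outside [O N] has a neighbourhood [C] with closure inside [A]. The
   pieces are then the part of [K] in the closure of [C] and the part outside an open [W] contained
   in [C]. *)
have [C nC CA] := compact_normal hX cX cD ((set_nbhsP _ _).2
  (ex_intro _ A (And3 oA DA (@subset_refl _ A)))).
have KC : closed (K `&` closure C) by apply: closedI => //; exact: closed_closure.
have [W [oW DW WC]] := (set_nbhsP _ _).1 nC.
have KW : closed (K `\` W).
  by rewrite setDE; apply: closedI => //; exact: open_closedC.
have KE : K = (K `&` closure C) `|` (K `\` W).
  apply/seteqP; split=> [x Kx|x [[]|[]]//]; have [Wx|nWx] := pselect (W x).
    by left; split=> //; apply: subset_closure; exact: WC.
  by right.
rewrite {1}KE; apply: (@le_trans _ _ ((lam (K `&` closure C))%:E + (lam (K `\` W))%:E)).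
  by rewrite -EFinD lee_fin; apply: (fa_leU fa) => //; exact: measurable_closed.
apply: leeD; first by apply: IH => // x [_ /CA].
apply: closed_inner_ge => // x [Kx nWx]; apply: contrapT => nOx.
by apply: nWx; exact: DW.
Qed.

(** A closed subset of the union is compact, hence covered by finitely many [O n]. This is how
    countable subadditivity arises from a merely finitely additive [lam]. *)
Lemma closed_inner_bigcup (O : (set X)^nat) : (forall n, open (O n)) ->
  closed_inner (\bigcup_n O n) <= \sum_(n <oo) closed_inner (O n).
Proof.
move=> oO; apply: ge_ereal_sup => _ [K [cK KO] <-].
have : compact K by exact: subclosed_compact cX _.
rewrite compact_cover => /(_ nat setT O (fun n _ => oO n) KO)[D _ KD].
pose N := (\max_(i <- D) i).+1.
apply: (@le_trans _ _ (\sum_(0 <= n < N) closed_inner (O n))); last first.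
  by apply: nneseries_lim_ge => n _ _; exact: closed_inner_ge0.
rewrite big_mkord; apply: closed_inner_sumU => // x /KD[n /= nD Ox].
rewrite -bigcup_mkord; exists n => //=.
by rewrite /N ltnS; exact: (@leq_bigmax_seq _ _ xpredT id).
Qed.

Lemma regularize_le A O : open O -> A `<=` O -> regularize A <= closed_inner O.
Proof. by move=> oO AO; apply: ereal_inf_lbound; exists O. Qed.

Lemma regularize_open O : open O -> regularize O = closed_inner O.
Proof.
move=> oO; apply/eqP; rewrite eq_le regularize_le//=.
by apply: le_ereal_inf_tmp => _ [A [oA OA] <-]; exact: closed_inner_mono.
Qed.

Lemma regularize0 : regularize set0 = 0.
Proof.
rewrite regularize_open; last exact: open0.
apply/eqP; rewrite eq_le closed_inner_ge0 andbT.
by apply: ge_ereal_sup => x [K [_ +] <-]; rewrite subset0 => ->; rewrite (fa_set0 fa).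
Qed.

Lemma regularize_ge0 A : 0 <= regularize A.
Proof. by apply: le_ereal_inf_tmp => _ [B _ <-]; exact: closed_inner_ge0. Qed.

Lemma regularize_mono : {homo regularize : A B / A `<=` B >-> A <= B}.
Proof.
move=> A B AB; apply: ereal_inf_le_tmp => _ [ O [oO BO] <-]; exists O => //.
by split=> //; exact: subset_trans BO.
Qed.

Lemma regularize_le1 A : regularize A <= 1.
Proof. by apply: le_trans (closed_inner_le1 setT); apply: regularize_le => //; exact: openT. Qed.

Lemma regularize_fin A : regularize A \is a fin_num.
Proof.
by rewrite ge0_fin_numE ?regularize_ge0// (le_lt_trans (regularize_le1 A))// ltry.
Qed.

Lemma regularize_sigma_subadditive : sigma_subadditive regularize.
Proof.
move=> A; apply/lee_addgt0Pr => e e0.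
apply: le_trans (epsilon_trick xpredT (fun n => regularize_ge0 (A n)) (ltW e0)).
have /choice[ O HO] n : exists O, [/\ open O, A n `<=` O &
    closed_inner O <= regularize (A n) + (e / (2 ^ n.+1)%:R)%:E].
  have en0 : (0 < e / (2 ^ n.+1)%:R)%R by rewrite divr_gt0.
  have [_ [ O [oO AO] <-] /ltW le] := lb_ereal_inf_adherent en0 (regularize_fin (A n)).
  by exists O.
apply: (@le_trans _ _ (closed_inner (\bigcup_n O n))).
  apply: regularize_le; first by apply: bigcup_open => n _; have [] := HO n.
  by apply: subset_bigcup => n _; have [] := HO n.
apply: (le_trans (closed_inner_bigcup _)); first by move=> n; have [] := HO n.
apply: lee_nneseries => n _; last by have [] := HO n.
by move=> _; exact: closed_inner_ge0.
Qed.

HB.instance Definition _ := isOuterMeasure.Build R X regularize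
  regularize0 regularize_ge0 regularize_mono regularize_sigma_subadditive.

(** Inside an open [B] around the test set, choose a closed [K] in the part of [B] in [O], then a
    closed [L] in [B] outside [K]. These are disjoint, so [lam] adds over them, and the open set of
    points of [B] outside [K] contains the part of the test set outside [O]. *)
Lemma regularize_caratheodory_open O : open O -> regularize.-caratheodory O.
Proof.
move=> oO; apply: le_caratheodory_measurable => A.
apply: le_ereal_inf_tmp => _ [B [oB AB] <-].
have finD : regularize (A `&` ~` O) \is a fin_num by exact: regularize_fin.
rewrite -leeBrDr//; apply: (@le_trans _ _ (closed_inner (B `&` O))).
  by apply: regularize_le; [exact: openI|exact: setSI].
apply: ge_ereal_sup => _ [K [cK KBO] <-].
rewrite leeBrDr// addeC -leeBrDr//.
apply: (@le_trans _ _ (closed_inner (B `\` K))).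
  apply: regularize_le; first by rewrite setDE; apply: openI => //; exact: closed_openC.
  by move=> x [/AB Bx nOx]; split=> // /KBO[].
apply: ge_ereal_sup => _ [L [cL LBK] <-].
rewrite leeBrDr//; have [_ _ lamU] := fa.
rewrite -EFinD -lamU; [|exact: measurable_closed|exact: measurable_closed|].
  by apply: closed_inner_ge; [exact: closedU|move=> x [/LBK[]|/KBO[]]].
by rewrite -subset0 => x [/LBK[]].
Qed.

Lemma regularize_caratheodory A : measurable (A : set (borel X)) ->
  regularize.-caratheodory A.
Proof.
have sC : sigma_algebra setT (regularize.-caratheodory : set (set X)).
  split; first exact: caratheodory_measurable_set0.
  - by move=> B; rewrite setTD; exact: caratheodory_measurable_setC.
  - exact: caratheodory_measurable_bigcup.
apply: smallest_sub => //; exact: regularize_caratheodory_open.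
Qed.

Definition regular_measure : set (borel X) -> \bar R := regularize.

Lemma regular_measure_sigma_additive : semi_sigma_additive regular_measure.
Proof.
move=> F mF tF mUF; apply: caratheodory_measure_sigma_additive => //.
  by move=> n; exact: regularize_caratheodory.
exact: regularize_caratheodory.
Qed.

HB.instance Definition _ := isMeasure.Build _ _ _ regular_measure
  regularize0 regularize_ge0 regular_measure_sigma_additive.

(** [K] itself competes in [closed_inner O] for every open [O] around it. Thus no mass is lost on
    closed sets, the fact on which the later limit arguments rest. *)
Lemma regular_measure_closed K : closed K -> (lam K)%:E <= regular_measure K.
Proof.
by move=> cK; apply: le_ereal_inf_tmp => _ [ O [oO KO] <-]; exact: closed_inner_ge.
Qed.

Lemma regular_measureT : regular_measure setT = 1.
Proof.
apply/eqP; rewrite eq_le regularize_le1 /=; case: (fa) => _ <- _.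
exact/regular_measure_closed/closedT.
Qed.

HB.instance Definition _ := Measure_isProbability.Build _ _ _ regular_measure
  regular_measureT.

Definition regular_probability : probability (borel X) R := regular_measure.

(** A homeomorphism carries open covers of [A] and the closed sets inside them to those of the
    preimage, with the same values of [lam]. Applied to the inverse as well, it gives equality. *)
Lemma regularize_preimage_le (f g : X -> X) A : continuous f -> continuous g ->
  cancel f g -> cancel g f ->
  (forall A : set (borel X), measurable A -> lam (f @^-1` A) = lam A) ->
  regularize (f @^-1` A) <= regularize A.
Proof.
move=> cf cg fK gK lamf; apply: le_ereal_inf_tmp => _ [ O [oO AO] <-].
apply: (@le_trans _ _ (closed_inner (f @^-1` O))).
  apply: regularize_le; last exact: preimage_subset.
  by apply: open_comp => // x _; exact: cf.
apply: ge_ereal_sup => _ [K [cK KO] <-].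
have cgK : closed (g @^-1` K) by apply: preimage_closed => // x _; exact: cg.
have -> : K = f @^-1` (g @^-1` K).
  by rewrite -comp_preimage; apply/seteqP; split=> x; rewrite /= fK.
rewrite lamf; last exact: measurable_closed.
by apply: closed_inner_ge => // x /KO /=; rewrite gK.
Qed.

End Regularization.

Lemma regularization (R : realType) (X : ptopologicalType)
    (lam : set (borel X) -> R) : hausdorff_space X -> compact [set: X] ->
  finitely_additive_probability lam ->
  exists mu : probability (borel X) R,
    (forall K : set X, closed K -> ((lam K)%:E <= mu K)%E) /\
    (forall f g : X -> X, continuous f -> continuous g -> cancel f g ->
      cancel g f ->
      (forall A : set (borel X), measurable A -> lam (f @^-1` A) = lam A) ->
      forall A : set (borel X), measurable A -> mu (f @^-1` A) = mu A).
Proof.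
move=> hX cX fa; exists (regular_probability hX cX fa); split.
  by move=> K cK; exact: regular_measure_closed.
move=> f g cf cg fK gK lamf A mA; apply/eqP; rewrite eq_le.
have -> /= : (regularize lam (f @^-1` A) <= regularize lam A)%E.
  exact: regularize_preimage_le cf cg fK gK lamf.
have lamg (B : set (borel X)) : measurable B -> lam (g @^-1` B) = lam B.
  move=> mB; rewrite -lamf; last exact: measurable_preimage.
  by congr lam; apply/seteqP; split=> x; rewrite /= fK.
have := regularize_preimage_le (f @^-1` A) cg cf gK fK lamg.
suff -> : g @^-1` (f @^-1` A) = A by [].
by apply/seteqP; split=> x; rewrite /= gK.
Qed.

(** * Borel sets of products and Fubini for invariant measures *)

Lemma measurable_bigcup_countable d (T : measurableType d) (D : set (set T)) :
  countable D -> (forall A, D A -> measurable A) ->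
  measurable (\bigcup_(A in D) A).
Proof.
move=> /pfcard_geP[->|[f]] mD; first by rewrite bigcup_set0.
suff -> : \bigcup_(A in D) A = \bigcup_n f n.
  by apply: bigcupT_measurable => n; apply: mD; exact: funS.
apply/seteqP; split=> [x [A DA Ax]|x [n _ fx]].
  by have [n _ fn] := @surj _ _ _ _ f _ DA; exists n => //; rewrite fn.
by exists (f n) => //; exact: funS.
Qed.

(** Second countability makes [W] a countable union of open rectangles. Continuous maps on the
    product are thus measurable for the product of the Borel sigma-algebras, as Fubini requires. *)
Lemma measurable_open_prod (S H : ptopologicalType) (W : set (S * H)) :
  @second_countable S -> @second_countable H -> open W ->
  measurable (W : set (borel S * borel H)).
Proof.
move=> [B cB [oB Bx]] [C cC [oC Cx]] oW.
pose D := [set bc : set S * set H | [/\ B bc.1, C bc.2 & bc.1 `*` bc.2 `<=` W]].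
have -> : W = \bigcup_(A in [set bc.1 `*` bc.2 | bc in D]) A.
  apply/seteqP; split=> [[x y] Wxy|[x y] [_ [[b c] /= [Bb Cc bcW] <-]]]; last exact: bcW.
  have [[U V] /= [nU nV] UV] : nbhs (x, y) W by exact: open_nbhs_nbhs.
  have [b [Bb bx] /= bU] := Bx x _ nU; have [c [Cc cy] /= cV] := Cx y _ nV.
  exists (b `*` c) => //; exists (b, c) => //; split=> // z [/bU Uz /cV Vz].
  by apply: UV.
apply: (@measurable_bigcup_countable _ (borel S * borel H)%type).
  apply: sub_countable (card_image_le _ _) _.
  apply: (@sub_countable _ _ _ (B `*` C)); last exact: countableX.
  by apply: subset_card_le => -[b c] [].
move=> _ [[b c] /= [/oB ob /oC oc _] <-].
by apply: measurableX; exact: measurable_open.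
Qed.

Lemma measurable_continuous_prod (S H X : ptopologicalType) (f : S * H -> X) :
  @second_countable S -> @second_countable H -> continuous f ->
  @measurable_fun _ _ (borel S * borel H)%type (borel X) setT f.
Proof.
move=> cS cH cf.
apply: (@measurability _ _ (borel S * borel H)%type (borel X) setT f (@open X)) => //.
move=> _ [B oB <-]; rewrite setTI; apply: measurable_open_prod => //.
by apply: open_comp => // x _; exact: cf.
Qed.

Section SigmaFinitePack.
Context d (T : measurableType d) (R : realType) (m : {measure set T -> \bar R}).
Hypothesis sf : sigma_finite setT m.

(** A copy of [m] that carries the sigma-finite structure expected by the Fubini lemmas, built from
    the proposition [sf]. *)
Definition sigma_finite_fun : set T -> \bar R := m.
HB.instance Definition _ := Measure.on sigma_finite_fun.
HB.instance Definition _ := Measure_isSigmaFinite.Build _ _ _ sigma_finite_fun sf.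
Definition sigma_finite_pack : {sigma_finite_measure set T -> \bar R} :=
  sigma_finite_fun.

End SigmaFinitePack.

Section InvariantFubini.
Local Open Scope ereal_scope.
Context {R : realType} {S H : ptopologicalType}.
Variables (m : {measure set (borel S) -> \bar R}).
Variables (mu : {measure set (borel H) -> \bar R}).
Hypotheses (sfm : sigma_finite setT m) (sfmu : sigma_finite setT mu).
Hypotheses (cS : @second_countable S) (cH : @second_countable H).
Variable (psi : S * H -> H).
Hypothesis (cpsi : continuous psi).
Variables (A : set S) (K : set H).
Hypotheses (mA : measurable (A : set (borel S))) (mK : measurable (K : set (borel H))).
Hypothesis mupsi : forall g, mu [set y | K (psi (g, y))] = mu K.

Let C : set (borel S * borel H) := [set z | A z.1 /\ K (psi z)].

Let mC : measurable C.
Proof.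
have -> : C = (A `*` setT) `&` (psi @^-1` K) by apply/seteqP; split=> [[x y] [Ax Kx]|[x y] [[Ax _] Kx]].
apply: measurableI.
  exact: (@measurableX _ _ (borel S) (borel H) A setT mA measurableT).
rewrite -[_ @^-1` _]setTI.
by apply: measurable_continuous_prod.
Qed.

Let CE y : ysection C y = A `&` [set g | K (psi (g, y))].
Proof.
apply/seteqP; split=> x; rewrite /ysection /=; first by rewrite inE.
by move=> h; rewrite inE.
Qed.

Lemma measurable_slice y : measurable (A `&` [set g | K (psi (g, y))] : set (borel S)).
Proof. by rewrite -CE; exact: measurable_ysection. Qed.

Lemma measurable_fun_slice :
  measurable_fun setT
    ((fun y => m (A `&` [set g | K (psi (g, y))])) : borel H -> \bar R).
Proof.
have := measurable_fun_ysection (sigma_finite_pack sfm) mC.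
by under [X in _ X -> _]eq_fun do rewrite /= CE.
Qed.

(** Both sides are the product measure of [C]: its section over a point of [A] has mass [mu K] by
    invariance, and its sections over points of [H] are the sets on the right. *)
Lemma invariant_fubini :
  m A * mu K = \int[mu]_y m (A `&` [set g | K (psi (g, y))]).
Proof.
have /esym := indic_fubini_tonelli (sigma_finite_pack sfm) (sigma_finite_pack sfmu) mC.
rewrite indic_fubini_tonelli_FE // indic_fubini_tonelli_GE //=.
move=> H1.
transitivity (\int[m]_(x in A) cst (mu K) x); first by rewrite integral_cst// muleC.
transitivity (\int[m]_x mu (xsection C x)).
  rewrite integral_mkcond; apply: eq_integral => x _; rewrite patchE.
  case: ifPn => [|nAx].
    rewrite inE => Ax; rewrite -(mupsi x); congr (mu _).
    by apply/seteqP; split=> y; rewrite /xsection /= inE // => -[].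
  rewrite -[LHS](measure0 mu); congr (mu _); apply/seteqP; split=> // y.
  by rewrite /xsection /= inE => -[Ax]; move: nAx; rewrite notin_setE.
by rewrite [LHS](esym H1); apply: eq_integral => y _ /=; rewrite -CE.
Qed.

End InvariantFubini.

(** * Ultralimits and extreme points *)

Section Ultralimits.
Context {R : realType} (U : set_system nat) {UU : UltraFilter U}.
Implicit Types u v : nat -> R.

(** The values stay in a compact interval, and an ultrafilter converges to any of its cluster
    points. *)
Lemma ultra_cvg u : (forall k, 0 <= u k <= 1) -> cvg (u @ U).
Proof.
move=> u01; have /(_ (u @ U)) := @segment_compact R 0 1.
case; first by apply: (@nearW _ U) => k; rewrite /= in_itv /=.
move=> x [_ clx]; apply/cvg_ex; exists x => A nA.
have [//|UnA] := in_ultra_setVsetC (u @^-1` A) UU.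
by have [y []] := clx _ _ (UnA : (u @ U) (~` A)) nA.
Qed.

Lemma finitely_additive_ultralimit d (T : measurableType d) (lam : nat -> set T -> R) :
  (forall k, finitely_additive_probability (lam k)) ->
  finitely_additive_probability (fun A => lim (lam k A @[k --> U])).
Proof.
move=> fa; have bnd A : measurable A -> forall k, 0 <= lam k A <= 1.
  move=> mA k; have [lam0 lam1 _] := fa k; rewrite lam0//= -lam1.
  exact: (fa_le (fa k)).
have cv A : measurable A -> cvg (lam k A @[k --> U]).
  by move=> mA; apply: ultra_cvg => k; exact: bnd.
split=> [A mA||A B mA mB AB].
- apply: limr_ge; first exact: cv.
  by apply: nearW => k; have /andP[] := bnd _ mA k.
- rewrite (_ : (fun k => _) = cst 1); first exact: lim_cst.
  by apply/funext => k; have [] := fa k.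
- rewrite -limD; [|exact: cv|exact: cv].
  by congr (lim (_ @ U)); apply/funext => k; have [_ _ ->] := fa k.
Qed.

End Ultralimits.

Section StrictlyConvexMax.
Context {R : realType} (U : set_system nat) {UU : UltraFilter U}.
Hypothesis Uoo : forall N, U [set k | (N <= k)%N].
Implicit Types a b c : nat -> R.

Let w n : R := (2 ^+ n.+1)^-1.
Let w_gt0 n : 0 < w n. Proof. by rewrite invr_gt0 exprn_gt0. Qed.

Let S N a := \sum_(n < N) w n * a n ^+ 2.

(** The weights [w n] with [n >= N] sum to [2^-N] and the squares are at most 1, so [2^-N] bounds
    every tail. *)
Let S_tail N N' a : (N <= N')%N -> (forall n, 0 <= a n <= 1) ->
  S N' a + (2 ^+ N')^-1 <= S N a + (2 ^+ N)^-1.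
Proof.
move=> NN' a01; rewrite -(subnK NN'); elim: (N' - N)%N => [//|k IH].
apply: le_trans IH; rewrite addSn /S big_ord_recr /= -/(S _ a) -addrA lerD2l.
have -> : (2 ^+ (k + N))^-1 = w (k + N) + w (k + N) :> R.
  by rewrite /w exprS invfM; lra.
rewrite -/(w (k + N)) lerD2r ler_piMr ?(ltW (w_gt0 _))//.
by have /andP[a0 a1] := a01 (k + N)%N; rewrite exprn_ile1.
Qed.

Let S_le N N' a : (forall n, 0 <= a n <= 1) -> S N a <= S N' a + (2 ^+ N')^-1.
Proof.
move=> a01; have [NN'|/ltnW N'N] := leqP N N'; last first.
  by apply: le_trans (S_tail N'N a01); rewrite lerDl invr_ge0 exprn_ge0.
apply: (@le_trans _ _ (S N' a)); last by rewrite lerDl invr_ge0 exprn_ge0.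
rewrite /S -!(big_mkord xpredT (fun n => w n * a n ^+ 2)).
rewrite (@big_cat_nat _ _ _ N 0 N')//= lerDl sumr_ge0// => n _.
by rewrite mulr_ge0 ?sqr_ge0// ltW.
Qed.

(* The functional a |-> \sum_n 2^(-n-1) (a n)^2 is strictly convex and, on
   nonnegative sequences, monotone, hence attains its maximum over M at a point
   which is extreme in M. *)
Lemma exists_extreme (M : set (nat -> R)) : M !=set0 ->
  (forall a, M a -> forall n, 0 <= a n <= 1) ->
  (forall s : nat -> nat -> R, (forall k, M (s k)) ->
     exists2 a, M a & forall n, lim (s k n @[k --> U]) <= a n) ->
  exists2 a, M a & forall b c t, M b -> M c -> 0 < t < 1 ->
    (forall n, a n = t * b n + (1 - t) * c n) -> forall n, b n = c n.
Proof.
move=> [a0 Ma0] M01 Mlim.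
(* The truncated sums increase to the functional, so the supremum over all truncations and all of
   [M] is that of the functional. *)
pose V := [set S z.1 z.2 | z in [set z : nat * (nat -> R) | M z.2]].
have V_sup : has_sup V.
  split; first by exists (S 0 a0), (0%N, a0).
  exists 1 => _ [[N a] /= Ma <-].
  have := S_le N 0 (M01 _ Ma); rewrite /S big_ord0 expr0 invr1 add0r.
  exact.
have le_sup N a : M a -> S N a <= sup V.
  by move=> Ma; apply: ub_le_sup; [case: V_sup|exists (N, a)].
have /choice[s Hs] k : exists a, M a /\ exists N, sup V - k.+1%:R^-1 < S N a.
  have k0 : (0 : R) < k.+1%:R^-1 by rewrite invr_gt0.
  have [_ [[N a] /= Ma <-] lt] := sup_adherent k0 V_sup.
  by exists a; split=> //; exists N.
have [|a Ma Ha] := Mlim s; first by move=> k; have [] := Hs k.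
have s01 k n : 0 <= s k n <= 1 by apply: M01; have [] := Hs k.
have s_cvg n : cvg (s k n @[k --> U]) by apply: ultra_cvg => k; exact: s01.
have l0 n : 0 <= lim (s k n @[k --> U]).
  by apply: limr_ge => //; apply: nearW => k; have /andP[] := s01 k n.
have supS N : sup V <= S N a + (2 ^+ N)^-1.
  apply: (@le_trans _ _ (S N (fun n => lim (s k n @[k --> U])) + (2 ^+ N)^-1)).
    have cS : S N (s k) @[k --> U] --> S N (fun n => lim (s k n @[k --> U])).
      rewrite /S; elim: N => [|N IH].
        under eq_fun do rewrite big_ord0.
        by rewrite big_ord0; exact: cvg_cst.
      under eq_fun do rewrite big_ord_recr /=.
      rewrite big_ord_recr /=; apply: cvgD => //; apply: cvgM; first exact: cvg_cst.
      rewrite expr2; under eq_fun do rewrite expr2.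
      by apply: cvgM; exact: s_cvg.
    rewrite -lerBlDr -(cvg_lim (@Rhausdorff R) cS).
    apply/ler_addgt0Pr => e e0.
    have cSe : cvg ((S N (s k) + e) @[k --> U]).
      by apply: is_cvgD; [apply/cvg_ex; eexists; exact: cS|exact: is_cvg_cst].
    rewrite -[X in _ <= _ + X](@lim_cst _ (@Rhausdorff R) _ U _ e) -limD//; last 2 first.
    - by apply/cvg_ex; eexists; exact: cS.
    - exact: is_cvg_cst.
    apply: limr_ge => //; have [K _ HK] := near_infty_natSinv_lt (PosNum e0).
    apply: filterS (Uoo K) => k Kk; have [_ [N' lt]] := Hs k.
    (* [S_le] trades the uncontrolled truncation [N'] of the near-maximizer for the fixed [N], at
       the cost [2^-N]. *)
    have le := S_le N' N (s01 k); have := HK k Kk; rewrite /= => xe.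
    rewrite lerBlDr addrAC; apply: ltW; rewrite -ltrBlDr.
    apply: lt_le_trans le; apply: le_lt_trans lt; rewrite lerD2l lerN2.
    exact: ltW.
  rewrite lerD2r /S; apply: ler_sum => n _; apply: ler_wpM2l; first exact: ltW.
  by rewrite ler_sqr ?nnegrE//; apply: le_trans (Ha n).
exists a => // b c t Mb Mc /andP[t0 t1] abc n.
apply/eqP; rewrite -subr_eq0 -sqrf_eq0 eq_le sqr_ge0 andbT.
(* Strict convexity in exact form: the convex combination of squares exceeds the square of the
   combination by [t (1 - t) (b - c)^2]. As [a] is maximal up to [2^-N], this excess is at most
   [2^-N]. *)
have D N : S N a + t * (1 - t) * S N (fun n => b n - c n) =
    t * S N b + (1 - t) * S N c.
  rewrite /S !mulr_sumr -!big_split /=; apply: eq_bigr => i _.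
  rewrite abc; ring.
have t1t : 0 < t * (1 - t) by rewrite mulr_gt0// subr_gt0.
rewrite -(pmulr_lle0 _ (w_gt0 n)) -(pmulr_rle0 _ t1t).
apply/ler_addgt0Pr => e e0; rewrite add0r.
have [K _ HK] := near_infty_natSinv_expn_lt (PosNum e0).
(* The truncation [K + n.+1] is beyond the threshold for [e] and also includes the index [n]. *)
have := HK (K + n.+1)%N (leq_addr _ _); rewrite /= => /ltW le; apply: le_trans le.
rewrite div1r.
set N := (K + n.+1)%N.
apply: (@le_trans _ _ (t * (1 - t) * S N (fun n => b n - c n))).
  rewrite ler_pM2l// /S; have nN : (n < N)%N by rewrite /N addnS ltnS leq_addl.
  rewrite (bigD1 (Ordinal nN))//= mulrC lerDl sumr_ge0// => i _.
  by rewrite mulr_ge0 ?sqr_ge0// ltW.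
have := D N; have := supS N; have := le_sup N _ Mb; have := le_sup N _ Mc.
set x := S N b; set y := S N c; set z := S N a; set q := S N _.
move=> yV xV Vz Dq; have : t * x <= t * sup V by rewrite ler_pM2l.
have : (1 - t) * y <= (1 - t) * sup V by rewrite ler_pM2l// subr_gt0.
by move: Dq Vz; lra.
Qed.

End StrictlyConvexMax.

(** * Haar measure *)

Lemma fsume_const (R : realType) (I : choiceType) (D : set I) (x : \bar R) :
  finite_set D -> (\sum_(i \in D) x = counting D * x)%E.
Proof.
move=> fD; rewrite fsbig_finite// big_const_seq count_predT iter_addr_0.
by rewrite /counting asboolT// mule_natl.
Qed.

Section HaarMeasure.
Local Open Scope ereal_scope.
Context {R : realType} {G : topologicalZmodType}.
Hypothesis hG : lcsc G.
Variable m : {measure set (borel G) -> \bar R}.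
Hypothesis hm : haar_measure m.
Implicit Types (A B C V D : set G) (x y g : G).

Lemma measurable_translate A g : measurable (A : set (borel G)) ->
  measurable (translate A g : set (borel G)).
Proof.
move=> mA; rewrite translate_preimage.
by apply: measurable_preimage => //; exact: addl_continuous.
Qed.

Lemma haar_translate A g : measurable (A : set (borel G)) -> m (translate A g) = m A.
Proof. by have [_ _] := hm; apply. Qed.

Lemma haar_shift A g : measurable (A : set (borel G)) -> m [set x | A (x + g)%R] = m A.
Proof. by move=> mA; rewrite -(haar_translate g mA) translate_preimage. Qed.

Lemma haar_precompact A : measurable (A : set (borel G)) -> precompact A -> m A < +oo.
Proof.
rewrite precompactE => mA cA; have [fin _ _] := hm.
apply: le_lt_trans (fin _ cA); apply: le_measure; rewrite ?inE//.
  by apply: measurable_closed; exact: closed_closure.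
exact: subset_closure.
Qed.

(** By local compactness the precompact members of a countable base cover the group, and they have
    finite measure. *)
Lemma haar_sigma_finite : sigma_finite setT m.
Proof.
have [hd lG [B cB [oB Bx]]] := hG.
pose D := [set b | B b /\ precompact b].
have cD : countable D by apply: sub_countable cB; apply: subset_card_le => b [].
have Dx x : exists2 b, D b & b x.
  have [N [nN cN clN _]] := locally_compact_nbhs hd lG (@filterT _ (nbhs x) _).
  have [b [Bb bx] /= bN] := Bx x _ nN; exists b => //; split=> //.
  by apply: precompact_subset bN _; exact: compact_precompact.
have mD b : D b -> measurable (b : set (borel G)).
  by move=> [/oB ob _]; exact: measurable_open.
move: cD => /pfcard_geP[D0|[f]].
  by have [b] := Dx 0%R; rewrite D0.
have Df n : D (f n) by exact: funS.
exists f.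
  apply/esym/seteqP; split=> // x _; have [b Db bx] := Dx x.
  by have [n _ fn] := @surj _ _ _ _ f _ Db; exists n => //; rewrite fn.
by move=> n; split; [exact: mD|apply: haar_precompact; [exact: mD|case: (Df n)]].
Qed.

Lemma haar_unit : exists2 A : set G, open A /\ A 0%R & precompact A.
Proof.
have [hd lG _] := hG.
have [N [nN cN clN _]] := locally_compact_nbhs hd lG (@filterT _ (nbhs (0%R : G)) _).
exists N°; first by split; [exact: open_interior|exact: nN].
apply: (precompact_subset (@interior_subset _ N)).
exact: compact_precompact.
Qed.

Let sub_cont : continuous (fun z : G * G => (z.2 - z.1)%R).
Proof.
move=> z; apply: (@continuous_comp _ _ _ (fun z : G * G => (z.2, z.1))
  (fun z : G * G => (z.1 - z.2)%R)); last exact: sub_continuous.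
by apply: cvg_pair; [exact: cvg_snd|exact: cvg_fst].
Qed.

Lemma measurable_opp D : measurable (D : set (borel G)) ->
  measurable ([set x | D (- x)%R] : set (borel G)).
Proof.
move=> mD; apply: (@measurable_preimage G G -%R D) => //.
exact: opp_continuous.
Qed.

(** Two applications of Fubini, with the maps [y - x] and [x + y], write [m A] times the measure of
    [- D] and [m D * m A] as integrals over slices that are translates of each other. The factor
    [m A] is positive and finite, so it cancels. *)
Lemma haar_opp D : measurable (D : set (borel G)) -> m [set x | D (- x)%R] = m D.
Proof.
move=> mD; have [hd lG cG] := hG; have [A [oA A0] pA] := haar_unit.
have mA : measurable (A : set (borel G)) by exact: measurable_open.
have mAfin : m A \is a fin_num.
  by rewrite ge0_fin_numE// haar_precompact.
have mA0 : 0 < m A by have [_ pos _] := hm; apply: pos => //; exists 0%R.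
have mD' := measurable_opp mD.
have shift (K : set G) g : measurable (K : set (borel G)) ->
  measurable ([set x | K (x + g)%R] : set (borel G)).
  by move=> mK; have := measurable_translate g mK; rewrite translate_preimage.
have I1 := invariant_fubini haar_sigma_finite haar_sigma_finite cG cG sub_cont mA mD'
  (fun g => haar_shift (- g)%R mD').
have add_cont : continuous (fun z : G * G => (z.1 + z.2)%R) by exact: add_continuous.
have addr_inv g : m [set y | A (g + y)%R] = m A.
  by under eq_set do rewrite addrC; exact: haar_shift.
have I2 := invariant_fubini haar_sigma_finite haar_sigma_finite cG cG add_cont mD mA
  addr_inv.
apply/eqP; rewrite eq_le -(lee_pmul2l _ mA0)// -[X in _ && X](lee_pmul2l _ mA0)//.
rewrite -eq_le I1 muleC I2; apply/eqP/eq_integral => x _ /=.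
rewrite -[RHS](haar_shift (- x)%R).
  by congr (m _); apply/seteqP; split=> y /=; rewrite subrK opprB => -[].
by apply: measurableI => //; exact: shift.
Qed.

Lemma haar_reflect D x : measurable (D : set (borel G)) ->
  m [set y | D (x - y)%R] = m D.
Proof.
move=> mD; rewrite -[RHS]haar_opp// -(haar_shift (- x)%R (measurable_opp mD)).
by congr (m _); apply/seteqP; split=> y /=; rewrite opprB.
Qed.

Lemma haar_setadd_finite (S V : set G) : finite_set S ->
  measurable (V : set (borel G)) ->
  (forall s s' v v', S s -> S s' -> V v -> V v' -> (s + v = s' + v')%R -> s = s') ->
  measurable (setadd S V : set (borel G)) /\ m (setadd S V) = counting S * m V.
Proof.
move=> fS mV inj; have SVE : setadd S V = \bigcup_(s in S) translate V (- s)%R.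
  apply/seteqP; split=> [_ [s Ss [v Vv <-]]|x [s Ss /translateE Vx]].
    by exists s => //; apply/translateE; rewrite addrAC subrr add0r.
  by exists s => //; exists (x - s)%R => //; rewrite addrC subrK.
split; rewrite SVE; first by apply: fin_bigcup_measurable => // s _; exact: measurable_translate.
rewrite measure_fin_bigcup//.
- rewrite -fsume_const//; apply: eq_fsbigr => s _; exact: haar_translate.
- move=> s s' Ss Ss' [x [/translateE Vx /translateE Vx']].
  by apply: inj Vx Vx' _ => //; rewrite !(addrC _ (x - _)%R) !subrK.
- by move=> s _; exact: measurable_translate.
Qed.

End HaarMeasure.

(** * Cross-section and transverse measure *)

Section CrossSection.
Context {G : topologicalZmodType}.
Hypothesis hG : lcsc G.
Variables (Po U : set G).
Hypotheses (oU : open U) (U0 : U 0) (UPo : unif_separated U Po).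
Implicit Types (V W E : set G) (B : set (closedSet G)) (Q : closedSet G).

Definition sweep V B : set (closedSet G) := [set closed_act v P | v in V & P in B].

Lemma sweepE V B Q : sweep V B Q <-> exists2 v, V v & B (closed_act (- v) Q).
Proof.
split=> [[v Vv [P BP <-]]|[v Vv BvQ]]; first by exists v; rewrite ?closed_actK.
by exists v => //; exists (closed_act (- v) Q); rewrite ?closed_actNK.
Qed.

Lemma hull_actE g Q : hull Po (closed_act g Q) <-> hull Po Q.
Proof.
have [hd lG _] := hG.
split; last exact: hull_act.
by move=> /(hull_act hd lG (g := - g)); rewrite closed_actK.
Qed.

Lemma cross_sectionE Q : cross_section Po Q <-> hull Po Q /\ closed_set Q 0.
Proof.
split=> [[[hQ _] Q0]//|[hQ Q0]]; split=> //; split=> // QE.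
by rewrite QE in Q0.
Qed.

Lemma cross_section_actE g Q :
  cross_section Po (closed_act g Q) <-> hull Po Q /\ closed_set Q g.
Proof. by rewrite cross_sectionE hull_actE closed_actE add0r. Qed.

(** The hypotheses say that [- v] and [- w] are points of [Q], a member of the hull, and they differ
    by an element of [U]. *)
Lemma cross_section_inj Q v w : cross_section Po (closed_act (- v) Q) ->
  cross_section Po (closed_act (- w) Q) -> U (v - w) -> v = w.
Proof.
have [hd _ _] := hG.
move=> /cross_section_actE[hQ Qv] /cross_section_actE[_ Qw] Uvw.
apply/esym/oppr_inj; apply: (hull_separated hd oU UPo hQ) => //.
by rewrite opprK addrC.
Qed.

Lemma measurable_hull : measurable (hull Po : set (borel (closedSet G))).
Proof. by apply: measurable_closed; exact: closed_hull. Qed.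

Lemma closed_containing (g : G) : closed [set Q : closedSet G | closed_set Q g].
Proof.
have -> : [set Q : closedSet G | closed_set Q g] = ~` avoiding [set g].
  apply/seteqP; split=> Q /=; first by move=> Qg; apply/notin_avoiding; exists g.
  by move=> /notin_avoiding[x Qx <-].
by apply: open_closedC; apply: open_avoiding; exact: compact_set1.
Qed.

Lemma cross_section_closed : closed (cross_section Po).
Proof.
have -> : cross_section Po = hull Po `&` [set Q : closedSet G | closed_set Q 0].
  by apply/seteqP; split=> Q /cross_sectionE.
by apply: closedI; [exact: closed_hull|exact: closed_containing].
Qed.

(** The reflection of [V] appears because the action subtracts. In this form the sweep of the whole
    cross-section is relatively open for open [V] and closed for compact [V]. *)
Lemma sweep_cross_section V :
  sweep V (cross_section Po) = hull Po `&` hitting [set x | V (- x)].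
Proof.
apply/seteqP; split=> Q.
  move=> /sweepE[v Vv /cross_section_actE[hQ Qv]]; split=> //.
  by exists (- v); split=> //=; rewrite opprK.
move=> [hQ [x [Qx Vx]]]; apply/sweepE; exists (- x) => //.
by apply/cross_section_actE; rewrite opprK.
Qed.

(** By [cross_section_inj] the parameter in [E] is unique, so a point leaves the sweep of [B] by [V]
    only because its parameter is outside [V] or its base point is outside [B]. *)
Lemma sweep_setD E V B : (forall x y, E x -> E y -> U (x - y)) ->
  V `<=` E -> B `<=` cross_section Po ->
  sweep E (cross_section Po) `\` sweep V B =
  sweep (E `\` V) (cross_section Po) `|` sweep E (cross_section Po `\` B).
Proof.
move=> EU VE BT; apply/seteqP; split=> Q.
  move=> [/sweepE[v Ev TvQ] nVB].
  have [Vv|nVv] := pselect (V v); last by left; apply/sweepE; exists v.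
  by right; apply/sweepE; exists v => //; split=> // BQ; apply: nVB; apply/sweepE; exists v.
move=> [/sweepE[v [Ev nVv] TQ]|/sweepE[v Ev [TQ nBQ]]].
  split; first by apply/sweepE; exists v.
  move=> /sweepE[w Vw BQ]; apply: nVv; rewrite (_ : v = w)//.
  by apply: (cross_section_inj TQ (BT _ BQ)); apply: EU => //; exact: VE.
split; first by apply/sweepE; exists v.
move=> /sweepE[w Vw BQ]; apply: nBQ; rewrite (_ : v = w)//.
by apply: (cross_section_inj TQ (BT _ BQ)); apply: EU => //; exact: VE.
Qed.

Lemma sweepI E V W B B' : (forall x y, E x -> E y -> U (x - y)) ->
  V `<=` E -> W `<=` E -> B `<=` cross_section Po -> B' `<=` cross_section Po ->
  sweep V B `&` sweep W B' = sweep (V `&` W) (B `&` B').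
Proof.
move=> EU VE WE BT BT'; apply/seteqP; split=> Q; last first.
  by move=> /sweepE[v [Vv Wv] [BQ BQ']]; split; apply/sweepE; exists v.
move=> [/sweepE[v Vv BQ] /sweepE[w Ww BQ']]; have vw : v = w.
  by apply: (cross_section_inj (BT _ BQ) (BT' _ BQ')); apply: EU; [exact: VE|exact: WE].
by apply/sweepE; exists v; split=> //; rewrite vw.
Qed.

Lemma sweep_bigcupl I (D : set I) (V : I -> set G) B :
  sweep (\bigcup_(i in D) V i) B = \bigcup_(i in D) sweep (V i) B.
Proof.
apply/seteqP; split=> Q; first by move=> /sweepE[v [i Di Vv] BQ]; exists i => //; apply/sweepE; exists v.
by move=> [i Di /sweepE[v Vv BQ]]; apply/sweepE; exists v => //; exists i.
Qed.

Lemma sweep_bigcupr I (D : set I) V (B : I -> set (closedSet G)) :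
  sweep V (\bigcup_(i in D) B i) = \bigcup_(i in D) sweep V (B i).
Proof.
apply/seteqP; split=> Q; first by move=> /sweepE[v Vv [i Di BQ]]; exists i => //; apply/sweepE; exists v.
by move=> [i Di /sweepE[v Vv BQ]]; apply/sweepE; exists v => //; exists i.
Qed.

Let msweep V B := measurable (sweep V B : set (borel (closedSet G))).

(* On a set E of small differences the point v of E for which closed_act (- v) Q
   contains 0 is unique, so that sweeping commutes with complements and the
   Borel sets can be reached from the open ones. *)
Lemma measurable_sweep_open E B : open E -> (forall x y, E x -> E y -> U (x - y)) ->
  measurable (B : set (borel (closedSet G))) ->
  msweep E (B `&` cross_section Po).
Proof.
have [hd lG _] := hG.
move=> oE EU mB; have mE : msweep E (cross_section Po).
  rewrite /msweep sweep_cross_section; apply: measurableI; first exact: measurable_hull.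
  apply: measurable_open; apply: open_hitting; apply: open_comp => // x _.
  exact: opp_continuous.
move: B mB; apply: smallest_sub; last first.
  (* For open [B] the sweep is cut out of that of the whole cross-section by an open condition; the
     two conditions may name different parameters [v] and [w], which coincide by
     [cross_section_inj]. *)
  move=> B oB; rewrite /msweep (_ : sweep _ _ = sweep E (cross_section Po) `&`
      [set Q | exists2 v, E v & (closed_set Q (- v)) /\ B (closed_act (- v) Q)]).
    apply: measurableI => //; apply: measurable_open.
    rewrite openE => Q [v Ev [Qv BQ]].
    have cont : continuous (fun z : G * closedSet G => closed_act z.1 z.2).
      exact: closed_act_continuous.
    have nB : nbhs (closed_act (- v) Q) B by exact: open_nbhs_nbhs.
    have [[C D] /= [nC nD] CD] := cont (- v, Q) _ nB.
    have nCE : nbhs (- v) (C `&` [set x | E (- x)]).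
      apply: filterI => //; apply: (@opp_continuous G (- v)); rewrite /= opprK.
      exact: open_nbhs_nbhs.
    have nh : nbhs Q (hitting (C `&` [set x | E (- x)])°).
      apply: open_nbhs_nbhs; split; first by apply: open_hitting; exact: open_interior.
      by exists (- v); split=> //; exact: nCE.
    apply: (filterS _ (filterI nD nh)) => Q' [DQ' [x [Q'x /interior_subset[Cx Ex]]]].
    exists (- x) => //; rewrite opprK; split=> //.
    exact: (CD (x, Q')).
  apply/seteqP; split=> [Q /sweepE[v Ev [BQ TQ]]|Q [/sweepE[v Ev TQ] [w Ew [Qw BQ]]]].
    split; first by apply/sweepE; exists v.
    exists v => //; split=> //.
    by move: TQ => /cross_section_actE[].
  apply/sweepE; exists v => //; split=> //.
  rewrite (_ : v = w)//; apply: (cross_section_inj TQ); last exact: EU.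
  by apply/cross_section_actE; split=> //; move: TQ => /cross_section_actE[].
split.
- by rewrite /msweep set0I (_ : sweep _ _ = set0)// -subset0 => Q /sweepE[].
- move=> B mB; rewrite /msweep setTD.
  rewrite (_ : sweep _ _ = sweep E (cross_section Po) `\` sweep E (B `&` cross_section Po)).
    exact: measurableD.
  rewrite sweep_setD// setDv (_ : sweep set0 _ = set0).
    rewrite set0U setDIr setDv setU0 setDE setIC //.
  by rewrite -subset0 => Q /sweepE[].
- move=> F mF; rewrite /msweep setI_bigcupl sweep_bigcupr.
  exact: bigcupT_measurable.
Qed.

(** Same induction over Borel sets as in [measurable_sweep_open], now on the side of [V], with the
    whole cross-section as base. *)
Lemma measurable_sweep_small E V : open E -> (forall x y, E x -> E y -> U (x - y)) ->
  measurable (V : set (borel G)) -> msweep (V `&` E) (cross_section Po).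
Proof.
move=> oE EU mV.
have mO W : open W -> msweep (W `&` E) (cross_section Po).
  move=> oW; rewrite /msweep sweep_cross_section; apply: measurableI.
    exact: measurable_hull.
  apply: measurable_open; apply: open_hitting.
  apply: (@open_comp _ _ -%R); first by move=> x _; exact: opp_continuous.
  exact: openI.
have mE : msweep E (cross_section Po) by rewrite -(setTI E); apply: mO; exact: openT.
move: V mV; apply: smallest_sub => //; split.
- by rewrite /msweep set0I (_ : sweep _ _ = set0)// -subset0 => Q /sweepE[].
- move=> V mV; rewrite /msweep setTD.
  rewrite (_ : sweep _ _ = sweep E (cross_section Po) `\` sweep (V `&` E) (cross_section Po)).
    exact: measurableD.
  rewrite sweep_setD// setDv (_ : sweep E set0 = set0).
    by rewrite setU0 setDIr setDv setU0 setDE setIC.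
  by rewrite -subset0 => Q /sweepE[].
- move=> F mF; rewrite /msweep setI_bigcupl sweep_bigcupl.
  exact: bigcupT_measurable.
Qed.

(** Countably many small basic open sets [E] cover [V]. On each of them uniqueness of the parameter
    separates the conditions on [V] and on [B], which are handled by the two preceding lemmas. *)
Lemma measurable_sweep V B : measurable (V : set (borel G)) ->
  measurable (B : set (borel (closedSet G))) -> B `<=` cross_section Po ->
  measurable (sweep V B : set (borel (closedSet G))).
Proof.
move=> mV mB BT; have [hd lG [C cC [oC Cx]]] := hG.
pose D := [set E | C E /\ forall x y, E x -> E y -> U (x - y)].
have cD : countable D by apply: sub_countable cC; apply: subset_card_le => E [].
have -> : V = \bigcup_(E in D) (V `&` E).
  apply/seteqP; split=> [x Vx|x [E _ []]//].
  have : nbhs (x - x) U by rewrite subrr; exact: open_nbhs_nbhs.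
  move=> /nbhs_sub[A [A' [nA nA' AA']]].
  have [E [CE Ex] /= EA] := Cx x _ (filterI nA nA').
  exists E => //; split=> // y z /EA[Ay _] /EA[_ Az]; exact: AA'.
rewrite sweep_bigcupl.
rewrite (_ : \bigcup_(E in D) _ = \bigcup_(S in (fun E => sweep (V `&` E) B) @` D) S).
  apply: (@measurable_bigcup_countable _ (borel (closedSet G))).
    exact: sub_countable (card_image_le _ _) cD.
  move=> _ [E [CE EU] <-]; have oE : open E by exact: oC.
  have -> : sweep (V `&` E) B =
      sweep (V `&` E) (cross_section Po) `&` sweep E (B `&` cross_section Po).
    rewrite (@sweepI E)//.
    rewrite -setIA setIid; congr sweep; apply/seteqP; split=> Q; last by move=> [_ []].
    by move=> BQ; split; [exact: BT|split=> //; exact: BT].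
  by apply: measurableI; [exact: measurable_sweep_small|exact: measurable_sweep_open].
by apply/seteqP; split=> Q [E DE SQ]; [exists (sweep (V `&` E) B) => //; exists E|
  move: DE SQ => [E' DE' <-]; exists E'].
Qed.

End CrossSection.

Lemma continuous_map_fst (S S' T : topologicalType) (f : S -> S') :
  continuous f -> continuous (fun z : S * T => (f z.1, z.2)).
Proof.
move=> cf [x y] A [[B C] /= [nB nC] BC].
by exists (f @^-1` B, C); [split=> //; exact: cf|move=> [x' y'] [? ?]; exact: BC].
Qed.

Section TransverseMeasure.
Local Open Scope ereal_scope.
Context {R : realType} {G : topologicalZmodType}.
Hypothesis hG : lcsc G.
Variable m : {measure set (borel G) -> \bar R}.
Hypothesis hm : haar_measure m.
Variable Po : set G.
Implicit Types (V U : set G) (B : set (closedSet G)) (Q : closedSet G).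

Definition slice V B Q : set G := [set x | B (closed_act (- x)%R Q)] `&` V.

Lemma measurable_reflect V x : measurable (V : set (borel G)) ->
  measurable ([set y | V (x - y)%R] : set (borel G)).
Proof.
move=> mV; apply: (@measurable_preimage G G (fun y => x - y)%R V) => //.
move=> y; apply: (@continuous_comp _ _ _ (fun y => (x, y))
  (fun z : G * G => (z.1 - z.2)%R)); first exact: continuous_pairl.
exact: sub_continuous.
Qed.

(* Both sides are the sum over the q in V1 + V2 for which closed_act (- q) Q lies
   in B of the Haar measure of V1 `&` (q - V2), which is that of V2 `&` (q - V1)
   because Haar measure is invariant under inversion. *)
Lemma haar_slice_sweep U1 U2 V1 V2 B Q : open U1 -> U1 0%R -> open U2 -> U2 0%R ->
  unif_separated U1 Po -> unif_separated U2 Po ->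
  measurable (V1 : set (borel G)) -> measurable (V2 : set (borel G)) ->
  precompact V1 -> precompact V2 -> setsub V1 V1 `<=` U1 -> setsub V2 V2 `<=` U2 ->
  B `<=` cross_section Po -> hull Po Q ->
  m (slice V1 (sweep V2 B) Q) = m (slice V2 (sweep V1 B) Q).
Proof.
move=> oU1 U10 oU2 U20 sU1 sU2 mV1 mV2 pV1 pV2 VU1 VU2 BT hQ.
have [hd lG _] := hG.
pose S := [set q | B (closed_act (- q)%R Q) /\ setadd V1 V2 q].
have SQ q : S q -> closed_set Q (- q)%R.
  by move=> [/BT/(cross_section_actE hG)[]].
have fS : finite_set S.
  pose N := [set x | setadd V1 V2 (- x)%R].
  apply: (@sub_finite_set _ _ (-%R @` (closed_set Q `&` N))).
    move=> q Sq; exists (- q)%R; last by rewrite opprK.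
    by split; [exact: SQ|rewrite /N /= opprK; case: Sq].
  apply: finite_image; apply: (@finite_separated _ U1).
  - exact: open_nbhs_nbhs.
  - exact: hull_separated hQ.
  have : precompact (setadd V1 V2) by exact: precompact_setadd.
  rewrite precompactE => cV; apply: (@precompact_subset _ _ (-%R @` closure (setadd V1 V2))).
    by move=> x Nx; exists (- x)%R; [exact: subset_closure|rewrite opprK].
  by apply: compact_precompact => //; exact: compact_opp.
pose F (V V' : set G) q := V `&` [set x | V' (q - x)%R].
have FE V V' : setadd V1 V2 = setadd V V' ->
    slice V (sweep V' B) Q = \bigcup_(q in S) F V V' q.
  move=> VE; apply/seteqP; split=> [x [/sweepE[w Vw] +] Vx|x [q [Bq _] [Vx V'x]]].
    rewrite closed_actD -opprD => BQ; exists (w + x)%R; last by split; rewrite //= addrK.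
    by split=> //; rewrite VE; exists x => //; exists w => //; rewrite addrC.
  split=> //; apply/sweepE; exists (q - x)%R => //.
  by rewrite closed_actD -opprD subrK.
have FF q : m (F V1 V2 q) = m (F V2 V1 q).
  rewrite -[RHS](haar_reflect hG hm q).
    by congr (m _); apply/seteqP; split=> y; rewrite /F /= subKr => -[].
  by apply: measurableI => //; exact: measurable_reflect.
have mF V V' q : measurable (V : set (borel G)) -> measurable (V' : set (borel G)) ->
    measurable (F V V' q : set (borel G)).
  by move=> mV mV'; apply: measurableI => //; exact: measurable_reflect.
have tF U V V' : open U -> unif_separated U Po -> setsub V' V' `<=` U -> trivIset S (F V V').
  move=> oU sU VU q q' Sq Sq' [x [[_ /= Vq] [_ /= Vq']]]; apply/esym/oppr_inj.
  apply: (hull_separated hd oU sU hQ); [exact: SQ|exact: SQ|].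
  rewrite opprK addrC; apply: VU; exists (q - x)%R => //; exists (q' - x)%R => //.
  by rewrite opprB addrA subrK.
rewrite (FE V1 V2)// (FE V2 V1); last first.
  by apply/seteqP; split=> _ [a Va [b Vb <-]]; exists b => //; exists a => //; rewrite addrC.
rewrite !measure_fin_bigcup//.
- by apply: eq_fsbigr => q _; exact: FF.
- exact: tF VU1.
- by move=> q _; exact: mF.
- exact: tF VU2.
- by move=> q _; exact: mF.
Qed.

Section invariant.
Variable mu : probability (borel (closedSet G)) R.
Hypothesis mu_inv : forall (g : G) (A : set (borel (closedSet G))), measurable A ->
  mu (closed_act g @` A) = mu A.

Lemma invariant_preimage g (A : set (borel (closedSet G))) : measurable A ->
  mu (closed_act g @^-1` A) = mu A.
Proof. by move=> mA; rewrite -(mu_inv (- g)%R mA) closed_act_image opprK. Qed.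

Lemma prob_sigma_finite : sigma_finite setT mu.
Proof. exact: sigma_finiteT. Qed.

(** The map [f] is the inversion in [sweep_identity] and the identity in [upper_bound]. *)
Lemma haar_fubini (f : G -> G) (V : set G) (K : set (closedSet G)) : continuous f ->
  measurable (V : set (borel G)) -> measurable (K : set (borel (closedSet G))) ->
  m V * mu K = \int[mu]_Q m (V `&` [set x | K (closed_act (f x) Q)]).
Proof.
have [hd lG cG] := hG; move=> cf mV mK.
have cact : continuous (fun z : G * closedSet G => closed_act (f z.1) z.2).
  move=> z; apply: (@continuous_comp _ _ _ (fun z : G * closedSet G => (f z.1, z.2))
    (fun z : G * closedSet G => closed_act z.1 z.2)); last exact: closed_act_continuous.
  exact: continuous_map_fst.
have := invariant_fubini (haar_sigma_finite hG hm) prob_sigma_finite cG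
  (second_countable_closedSet hd lG cG) cact mV mK.
by apply => g; exact: (@invariant_preimage (f g) K mK).
Qed.

Lemma measurable_fun_haar_slice (V : set G) (K : set (closedSet G)) :
  measurable (V : set (borel G)) -> measurable (K : set (borel (closedSet G))) ->
  measurable_fun setT ((fun Q => m (V `&` [set x | K (closed_act x Q)]))
    : borel (closedSet G) -> \bar R).
Proof.
have [hd lG cG] := hG; move=> mV mK.
have cact : continuous (fun z : G * closedSet G => closed_act z.1 z.2).
  exact: closed_act_continuous.
exact: (measurable_fun_slice (haar_sigma_finite hG hm) cG
  (second_countable_closedSet hd lG cG) cact mV mK).
Qed.

(** Integrating [haar_slice_sweep] over [mu]. It shows that the ratio of [mu (sweep V B)] to [m V]
    does not depend on [V], so one fixed [V] can define the transverse measure. *)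
Lemma sweep_identity U1 U2 V1 V2 B : open U1 -> U1 0%R -> open U2 -> U2 0%R ->
  unif_separated U1 Po -> unif_separated U2 Po ->
  measurable (V1 : set (borel G)) -> measurable (V2 : set (borel G)) ->
  precompact V1 -> precompact V2 -> setsub V1 V1 `<=` U1 -> setsub V2 V2 `<=` U2 ->
  measurable (B : set (borel (closedSet G))) -> B `<=` cross_section Po ->
  m V1 * mu (sweep V2 B) = m V2 * mu (sweep V1 B).
Proof.
move=> oU1 U10 oU2 U20 sU1 sU2 mV1 mV2 pV1 pV2 VU1 VU2 mB BT.
have oppc : continuous (-%R : G -> G) by exact: opp_continuous.
rewrite (haar_fubini oppc mV1); last exact: (measurable_sweep hG oU2 U20 sU2).
rewrite (haar_fubini oppc mV2); last exact: (measurable_sweep hG oU1 U10 sU1).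
apply: eq_integral => Q _; rewrite (setIC V1) (setIC V2).
have [hQ|nhQ] := pselect (hull Po Q).
  exact: (haar_slice_sweep oU1 U10 oU2 U20).
have E V V' : [set x | sweep V B (closed_act (- x)%R Q)] `&` V' = set0.
  rewrite -subset0 => x [/sweepE[w Vw /BT/(cross_section_actE hG)[hQ _]] _].
  by apply: nhQ; apply/(hull_actE hG _ (- x)%R).
by rewrite !E.
Qed.

End invariant.
End TransverseMeasure.

Section TransverseConstruction.
Local Open Scope ereal_scope.
Context {R : realType} {G : topologicalZmodType}.
Hypothesis hG : lcsc G.
Variable m : {measure set (borel G) -> \bar R}.
Hypothesis hm : haar_measure m.
Variables (Po U V : set G).
Hypotheses (oU : open U) (U0 : U 0%R) (sU : unif_separated U Po).
Hypotheses (mV : measurable (V : set (borel G))) (VU : setsub V V `<=` U).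
Hypotheses (pV : precompact V) (mV0 : 0 < m V).
Variable mu : probability (borel (closedSet G)) R.

Definition transverse (B : set (borel (closedSet G))) : \bar R :=
  ((fine (m V))^-1)%:E * mu (sweep V (B `&` cross_section Po)).

Let V_small x y : V x -> V y -> U (x - y)%R.
Proof. by move=> Vx Vy; apply: VU; exists x => //; exists y. Qed.

Let mVfin : m V \is a fin_num.
Proof. by rewrite ge0_fin_numE// haar_precompact. Qed.

Let mVinv0 : (0 <= (fine (m V))^-1)%R.
Proof. by rewrite invr_ge0 fine_ge0. Qed.

Let transverse0 : transverse set0 = 0.
Proof.
rewrite /transverse set0I (_ : sweep _ _ = set0) ?measure0 ?mule0//.
by rewrite -subset0 => Q /sweepE[].
Qed.

Let transverse_ge0 B : 0 <= transverse B.
Proof. by rewrite mule_ge0 ?lee_fin. Qed.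

Lemma measurable_cross_section :
  measurable (cross_section Po : set (borel (closedSet G))).
Proof. by apply: measurable_closed; exact: cross_section_closed. Qed.

Let mswp (B : set (closedSet G)) : measurable (B : set (borel (closedSet G))) ->
  measurable (sweep V (B `&` cross_section Po) : set (borel (closedSet G))).
Proof.
move=> mB; apply: (measurable_sweep hG oU U0 sU) => //.
by apply: measurableI => //; exact: measurable_cross_section.
Qed.

Let transverse_sigma_additive : semi_sigma_additive transverse.
Proof.
move=> F mF tF mUF; rewrite /transverse setI_bigcupl sweep_bigcupr.
have tS : trivIset setT (fun n => sweep V (F n `&` cross_section Po)).
  move=> i j _ _ [Q []]; move=> h1 h2; apply: tF => //.
  have : (sweep V (F i `&` cross_section Po) `&` sweep V (F j `&` cross_section Po)) Q by [].
  rewrite (sweepI hG oU sU V_small)//.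
  by move=> /sweepE[v _ [[Fi _] [Fj _]]]; exists (closed_act (- v)%R Q).
have cvg_mu : (fun n => \sum_(0 <= i < n) mu (sweep V (F i `&` cross_section Po))) @ \oo
    --> mu (\bigcup_n sweep V (F n `&` cross_section Po)).
  apply: measure_semi_sigma_additive => //; first by move=> n; exact: mswp.
  by apply: bigcupT_measurable => n; exact: mswp.
under eq_fun do rewrite -ge0_sume_distrr//.
by apply: cvgeZl.
Qed.

HB.instance Definition _ := isMeasure.Build _ _ _ transverse
  transverse0 transverse_ge0 transverse_sigma_additive.

Let transverse_fin : fin_num_fun transverse.
Proof.
move=> B mB; rewrite fin_numM//.
exact: fin_num_measure (mswp mB).
Qed.

HB.instance Definition _ := Measure_isFinite.Build _ _ _ transverse transverse_fin.

Definition transverse_measure : {finite_measure set (borel (closedSet G)) -> \bar R} :=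
  transverse.

Lemma transverse_measureE B : B `<=` cross_section Po ->
  m V * transverse_measure B = mu (sweep V B).
Proof.
move=> BT; rewrite /= /transverse (setIidl BT) muleA -[m V]fineK// -EFinM.
by rewrite divff ?mul1e// gt_eqF// fine_gt0// mV0 ltey_eq mVfin.
Qed.

Lemma is_transverse_transverse_measure :
  (forall (g : G) (A : set (borel (closedSet G))), measurable A ->
    mu (closed_act g @` A) = mu A) ->
  is_transverse_measure m Po mu transverse_measure.
Proof.
move=> mu_inv; split; first by move=> B mB; rewrite /= /transverse -setIA setIid.
move=> U' oU' pU' U'0 U'P V' B mV' V'U' mB BT.
have pV' : precompact V'.
  have [hd _ _] := hG.
  have [->|/set0P[v V'v]] := eqVneq V' set0.
    by apply: compact_precompact => //; exact: compact0.
  (* As [V' - V'] lies in the precompact set [U'], the set [V'] lies in [v + U']. *)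
  apply: (@precompact_subset _ _ (setadd [set v] U')).
    move=> w V'w; exists v => //; exists (w - v)%R; last by rewrite addrC subrK.
    by apply: V'U'; exists w => //; exists v.
  by apply: precompact_setadd => //; apply: compact_precompact => //; exact: compact_set1.
have sU' : unif_separated U' Po.
  by move=> p q Pp Pq; exact: unif_discrete_for_inj U'P Pp Pq.
have := sweep_identity hG hm mu_inv oU U0 oU' U'0 sU sU' mV mV' pV pV' VU V'U' mB BT.
rewrite -/(sweep V' B) -(transverse_measureE BT) => E.
have : m V * mu (sweep V' B) = m V * (m V' * transverse_measure B) by rewrite E muleCA.
move=> /eqP; rewrite eq_le !lee_pmul2l// -eq_le => /eqP; exact.
Qed.

End TransverseConstruction.

(** * Strong Folner sequences and the upper bound *)

Section LimSup.
Local Open Scope ereal_scope.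
Context {R : realType}.
Implicit Types (u v : nat -> \bar R) (c l : \bar R).

Lemma limn_esup_gt u c N : c < limn_esup u -> exists2 n, (N <= n)%N & c < u n.
Proof.
move=> cu; have : c < ereal_sup (u @` [set n | (N <= n)%N]).
  apply: lt_le_trans cu _; apply: ereal_inf_lbound.
  by exists [set n | (N <= n)%N] => //; exact: nbhs_infty_ge.
by move=> /ereal_sup_gt[_ [n Nn <-] cn]; exists n.
Qed.

Lemma limn_esup_ge u v (l : R) : (forall n, v n <= u n) ->
  v n @[n --> \oo] --> l%:E -> l%:E <= limn_esup u.
Proof.
move=> vu vl; apply: le_ereal_inf_tmp => _ [A nA <-].
apply/lee_subgt0Pr => e e0.
have : \forall n \near \oo, l%:E - e%:E < v n.
  apply: (vl [set y | l%:E - e%:E < y]); apply: open_nbhs_nbhs.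
  split; first exact: open_ereal_gt_ereal.
  by rewrite /= -?EFinB lte_fin ltrBlDr ltrDl.
move=> /(filterI nA)/filter_ex[n [An /ltW ln]].
apply: le_trans ln _; apply: le_trans (vu n) _.
by apply: ereal_sup_ubound; exists n.
Qed.

Lemma divE_fine (x a : \bar R) : x \is a fin_num -> a \is a fin_num -> 0 < a ->
  x / a = (fine x / fine a)%:E.
Proof.
case: x a => [x| |] [a| |]// _ _; rewrite lte_fin => a0.
by rewrite inver gt_eqF.
Qed.

Lemma le_div_fine (x x' a a' : \bar R) : x' \is a fin_num -> a \is a fin_num ->
  0 < a' -> 0 <= x -> x <= x' -> a' <= a -> x / a <= x' / a'.
Proof.
move=> fx' fa a'0 x0 xx' a'a; have fa' : a' \is a fin_num.
  by rewrite ge0_fin_numE ?ltW// (le_lt_trans a'a)// ltey_eq fa.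
have fx : x \is a fin_num by rewrite ge0_fin_numE// (le_lt_trans xx')// ltey_eq fx'.
have a0 : 0 < a by exact: lt_le_trans a'a.
rewrite !divE_fine// lee_fin; apply: ler_pM.
- exact: fine_ge0.
- by rewrite invr_ge0; exact/fine_ge0/ltW.
- exact: fine_le.
- by rewrite lef_pV2 ?posrE ?fine_gt0 ?a0 ?a'0 ?ltey_eq ?fa ?fa'// fine_le.
Qed.

Lemma cvg_div_inv (x a : nat -> \bar R) : (forall n, x n \is a fin_num) ->
  (forall n, a n \is a fin_num) -> (forall n, 0 < x n) -> (forall n, 0 < a n) ->
  x n / a n @[n --> \oo] --> 1 -> a n / x n @[n --> \oo] --> 1.
Proof.
move=> fx fa x0 a0 /fine_cvgP[_ cvg1].
have -> : (fun n => a n / x n) = (fun n => ((fine (x n / a n))^-1)%:E).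
  by apply/funext => n; rewrite !divE_fine// invf_div.
apply: cvg_EFin; first by apply: nearW.
rewrite -[1%R in X in _ --> X]invr1; apply: cvgV => //; exact: oner_neq0.
Qed.

End LimSup.

Section FolnerThickening.
Local Open Scope ereal_scope.
Context {R : realType} {G : topologicalZmodType}.
Hypothesis hG : lcsc G.
Variable m : {measure set (borel G) -> \bar R}.
Hypothesis hm : haar_measure m.
Implicit Types (A C O : set G).

Lemma mu_ext_translate_le A g : (mu_ext m (translate A g) <= mu_ext m A).
Proof.
apply: le_ereal_inf_tmp => _ [F [mF AF] <-].
apply: ereal_inf_lbound; exists (fun n => translate (F n) g).
  split=> [n|x /translateE/AF[n _ Fx]]; first exact: measurable_translate.
  by exists n => //; exact/translateE.
by apply: eq_eseriesr => n _; rewrite haar_translate.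
Qed.

Lemma mu_ext_le_measure A D : measurable (D : set (borel G)) -> A `<=` D ->
  mu_ext m A <= m D.
Proof. by move=> mD AD; rewrite -(measurable_mu_extE m mD); exact: le_mu_ext. Qed.

Lemma mu_ext_fin A : precompact A -> mu_ext m A \is a fin_num.
Proof.
rewrite precompactE => cA; rewrite ge0_fin_numE; last exact: mu_ext_ge0.
have [fin _ _] := hm; apply: le_lt_trans (fin _ cA).
apply: mu_ext_le_measure; last exact: subset_closure.
by apply: measurable_closed; exact: closed_closure.
Qed.

Lemma strong_folner_fin F n : strong_folner m F -> m (F n) \is a fin_num.
Proof.
move=> [HF _ _]; have [pF mF _] := HF n.
by rewrite ge0_fin_numE// haar_precompact.
Qed.

Lemma translate_precompact A g : precompact A -> precompact (translate A g).
Proof.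
have [hd _ _] := hG; move=> pA.
apply: (@precompact_subset _ _ (setadd A [set (- g)%R])).
  by move=> x /translateE Ax; exists (x + g)%R => //; exists (- g)%R => //; rewrite addrK.
apply: precompact_setadd => //; apply: compact_precompact => //; exact: compact_set1.
Qed.

(** The shift [h n] may vary with [n], as the translate of [Po] in which patterns are found will
    do. *)
Definition thicken (F : nat -> set G) O (h : nat -> G) n : set G :=
  translate (setadd (F n) O) (h n).

Variables (F : nat -> set G) (O : set G) (h : nat -> G).
Hypotheses (sF : strong_folner m (F : nat -> set (borel G))).
Hypotheses (oO : open O) (pO : precompact O) (O0 : O 0%R).

Let F' : nat -> set G := thicken F O h.

Let open_thicken n : open (F' n).
Proof. by apply: open_translate; exact: open_setadd. Qed.

Let measurable_thicken n : measurable (F' n : set (borel G)).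
Proof. exact: measurable_open. Qed.

Let precompact_thicken n : precompact (F' n).
Proof.
have [hd _ _] := hG; have [HF _ _] := sF; have [pF _ _] := HF n.
by apply: translate_precompact; exact: precompact_setadd.
Qed.

Let mF n : measurable (F n : set (borel G)).
Proof. by have [HF _ _] := sF; case: (HF n). Qed.

Let F_gt0 n : 0 < m (F n).
Proof. by have [HF _ _] := sF; case: (HF n). Qed.

Let thicken_sub n : translate (F n) (h n) `<=` F' n.
Proof.
move=> x /translateE Fx; apply/translateE; exists (x + h n)%R => //.
by exists 0%R => //; rewrite addr0.
Qed.

Lemma thicken_ge n : m (F n) <= m (F' n).
Proof.
rewrite -(haar_translate hm (h n) (mF n)); apply: le_measure; rewrite ?inE//.
exact: measurable_translate.
Qed.

Let thicken_gt0 n : 0 < m (F' n).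
Proof. exact: lt_le_trans (F_gt0 n) (thicken_ge n). Qed.

Lemma thicken_fin n : m (F' n) \is a fin_num.
Proof. by rewrite ge0_fin_numE// haar_precompact. Qed.

Let F_fin n : m (F n) \is a fin_num.
Proof. exact: strong_folner_fin. Qed.

(** Up to translation, [F' n + C] lies in [F n] plus the set [closure O + C], which is compact when
    [C] is; the first Folner condition for [F] thus controls the thickened sequence. *)
Let clO_setadd C n : mu_ext m (setadd (F' n) C) <=
  mu_ext m (setadd (F n) (setadd (closure O) C)).
Proof.
apply: le_trans (mu_ext_translate_le _ (h n)); apply: le_mu_ext => //.
move=> _ [x /translateE[f Ff [ o Oo foE]] [c Cc <-]]; apply/translateE.
exists f => //; exists (o + c)%R; last by rewrite addrA foE addrAC.
by exists o; [exact: subset_closure|exists c].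
Qed.

Let cvg_ratio_upper C : compact C -> C !=set0 ->
  mu_ext m (setadd (F n) (setadd (closure O) C)) / m (F n) @[n --> \oo] --> 1.
Proof.
move=> cC [c Cc]; have [_ HF _] := sF; apply: HF.
  by apply: compact_setadd => //; rewrite -precompactE.
by exists (0 + c)%R; exists 0%R; [exact: subset_closure|exists c].
Qed.

Let setadd_fin n C : compact C ->
  mu_ext m (setadd (F n) (setadd (closure O) C)) \is a fin_num.
Proof.
have [hd _ _] := hG; have [HF _ _] := sF; have [pF _ _] := HF n.
move=> cC; apply: mu_ext_fin; apply: precompact_setadd => //.
apply: compact_precompact => //; apply: compact_setadd => //.
by rewrite -precompactE.
Qed.

(** [m (F' n)] lies between [m (F n)] and the outer measure of [F n + closure O]; the resulting
    limit is then inverted. *)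
Lemma thicken_ratio : m (F n) / m (F' n) @[n --> \oo] --> 1.
Proof.
apply: cvg_div_inv => //; first by move=> n; exact: thicken_fin.
have c0 : compact [set 0%R : G] by exact: compact_set1.
apply: squeeze_cvge (cvg_cst _) (cvg_ratio_upper c0 _); last by exists 0%R.
apply: nearW => n; rewrite -(divee (F_fin n)) ?gt_eqF//.
apply/andP; split; apply: le_div_fine => //.
- exact: thicken_fin.
- exact: thicken_ge.
- exact: setadd_fin.
- rewrite -(measurable_mu_extE m (measurable_thicken n)).
  apply: le_trans (clO_setadd _ n); apply: le_mu_ext => //.
  by move=> x Fx; exists x => //; exists 0%R => //; rewrite addr0.
Qed.

(* O itself witnesses the second Folner condition: the intersection contains the
   translate of F n by h n, whose proportion in F' n tends to 1 by the first
   condition. *)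
Lemma strong_folner_thicken : strong_folner m (F' : nat -> set (borel G)).
Proof.
split=> //.
- move=> C cC C0; apply: squeeze_cvge (cvg_cst _) (cvg_ratio_upper cC C0).
  apply: nearW => n; apply/andP; split; last first.
    apply: le_div_fine => //; [exact: setadd_fin|exact: thicken_fin|exact: mu_ext_ge0|
      exact: thicken_ge].
  rewrite -(divee (thicken_fin n)) ?gt_eqF//; apply: le_div_fine => //.
  + have [hd _ _] := hG; apply: mu_ext_fin; apply: precompact_setadd => //.
    exact: compact_precompact.
  + exact: thicken_fin.
  case: C0 => c Cc; have mt := measurable_translate (- c)%R (measurable_thicken n).
  rewrite -(haar_translate hm (- c)%R (measurable_thicken n)) -(measurable_mu_extE m mt).
  apply: le_mu_ext => // x /translateE Fx.
  by exists (x - c)%R => //; exists c => //; rewrite subrK.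
- exists O; split=> //.
  have bE n : \bigcap_(v in O) translate (F' n) v =
      ~` \bigcup_(v in O) translate (~` F' n) v.
    rewrite setC_bigcup; apply: eq_bigcapr => v _; apply/seteqP; split=> x.
      by move=> /translateE F'x /translateE.
    by move=> nF; apply/translateE; apply: contrapT => nF'; apply: nF; apply/translateE.
  have mb n : measurable (\bigcap_(v in O) translate (F' n) v : set (borel G)).
    rewrite bE; apply: measurable_closed; apply: open_closedC.
    (* The complement of the intersection is a sum with the open set [- O], hence open, whatever the
       other summand is. *)
    rewrite (_ : \bigcup_(v in O) _ = setadd (~` F' n) [set x | O (- x)%R]).
      apply: open_setadd; apply: (@open_comp _ _ -%R) => // x _.
      exact: opp_continuous.
    apply/seteqP; split=> x.
      move=> [v Ov /translateE nF]; exists (x + v)%R => //; exists (- v)%R.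
        by rewrite /= opprK.
      by rewrite addrK.
    move=> [y nFy [v Ov <-]]; exists (- v)%R => //; apply/translateE.
    by rewrite addrK.
  apply: squeeze_cvge thicken_ratio (cvg_cst 1).
  have le1 n : m (\bigcap_(v in O) translate (F' n) v) <= m (F' n).
    apply: le_measure; rewrite ?inE// => x /(_ _ O0)/translateE.
    by rewrite addr0.
  apply: nearW => n; apply/andP; split.
    apply: le_div_fine => //; [|exact: thicken_fin|].
      by rewrite ge0_fin_numE// (le_lt_trans (le1 n))// ltey_eq thicken_fin.
    rewrite -(haar_translate hm (h n) (mF n)); apply: le_measure; rewrite ?inE//.
      exact: measurable_translate.
    move=> x /translateE Fx v Ov; apply/translateE/translateE.
    by exists (x + h n)%R => //; exists v => //; rewrite addrAC.
  rewrite -(divee (thicken_fin n)) ?gt_eqF//.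
  by apply: le_div_fine => //; exact: thicken_fin.
Qed.

End FolnerThickening.

Lemma counting_le_inj (R : realType) (T T' : choiceType) (A : set T) (B : set T')
    (f : T -> T') : finite_set A -> finite_set B -> (forall a, A a -> B (f a)) ->
  (forall a a', A a -> A a' -> f a = f a' -> a = a') ->
  (counting A <= counting B :> \bar R)%E.
Proof.
move=> /[dup] fA /finite_setP[n An] fB fAB finj.
rewrite /counting !asboolT// lee_fin ler_nat (card_fset_set An).
have /card_eqPle[_ nA] := An.
apply: leq_card_fset_set => //; apply: (card_le_trans nA).
have : {in A &, injective f} by move=> a a'; rewrite !inE; exact: finj.
move=> /inj_card_eq/card_eqPle[_ /card_le_trans]; apply.
by apply: subset_card_le => _ [a Aa <-]; exact: fAB.
Qed.

(** * Occurrences of patterns and the upper bound for sweeps *)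

Section UpperBound.
Local Open Scope ereal_scope.
Context {R : realType} {G : topologicalZmodType}.
Hypothesis hG : lcsc G.
Variable m : {measure set (borel G) -> \bar R}.
Hypothesis hm : haar_measure m.
Variables (Po U W : set G) (r : nat) (g : 'I_r -> G).
Hypotheses (oU : open U) (U0 : U 0%R) (sU : unif_separated U Po).
Hypotheses (oW : open W) (W0 : W 0%R).
Hypothesis gW : forall k p p', Po p -> Po p' -> W (p' - p - g k)%R ->
  (p' = p + g k)%R.
Implicit Types (A V : set G) (Q : closedSet G).

Definition pattern : set G := Po `&` \bigcap_k translate Po (g k).

Definition pattern_section : set (closedSet G) :=
  cross_section Po `&` \bigcap_k [set Q : closedSet G | closed_set Q (g k)].

Lemma pattern_section_closed : closed pattern_section.
Proof.
have [hd lG _] := hG; apply: closedI; first exact: cross_section_closed.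
by apply: closed_bigI => k _; exact: closed_containing.
Qed.

Lemma measurable_pattern_section :
  measurable (pattern_section : set (borel (closedSet G))).
Proof. by apply: measurable_closed; exact: pattern_section_closed. Qed.

(** The occurrences [q] of the pattern in [Q] for which [q + V] meets [A]. *)
Let S Q A V : set G :=
  [set q | closed_set Q q /\ forall k, closed_set Q (q + g k)%R] `&` setsub A V.

Lemma slice_pattern Q A V :
  A `&` [set x | sweep V pattern_section (closed_act x Q)] `<=` setadd (S Q A V) V.
Proof.
move=> x [Ax /sweepE[v Vv []]]; rewrite closed_actD addrC => /cross_section_actE -/(_ hG).
move=> [hQ Qxv] Qg; exists (x - v)%R; last by exists v => //; rewrite subrK.
split; last by exists x => //; exists v.
by split=> // k; have /= /translateE := Qg k I; rewrite (addrC (g k)).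
Qed.

(* Q is a Chabauty limit of translates of Po, so a translate of Po approximates
   it on bounded sets; a pattern of Q is met exactly, not just approximately, as
   a difference of points of Po close to g k is equal to g k. *)
Lemma pattern_approximation : exists V', [/\ open V', V' 0%R, precompact V' &
  forall Q A V, hull Po Q -> precompact A -> precompact V ->
    exists h, counting (S Q A V) <=
      counting (pattern `&` translate (setadd A (setsub V' V)) (- h)) :> \bar R].
Proof.
have [hd lG _] := hG.
(* One error set [B] serves twice: [B - B] inside [U] makes the transfer of occurrences injective,
   and [B - B] inside [W] makes the transferred patterns exact. *)
have [B [oB B0 BUW]] := nbhs_sub0 (open_nbhs_nbhs (conj (openI oU oW) (conj U0 W0))).
have [N [oN N0] pN] := haar_unit hG.
exists (B `&` N); split=> //.
- exact: openI.
- by apply: precompact_subset pN => x [].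
move=> Q A V hQ pA pV.
have pAV : precompact (setsub A V) by exact: precompact_setsub.
have sQ : unif_separated U Q by exact: hull_separated hQ.
have fQ : finite_set (closed_set Q `&` setsub A V).
  by apply: finite_separated sQ pAV; exact: open_nbhs_nbhs.
have fS : finite_set (S Q A V) by apply: sub_finite_set fQ => q [[Qq _] AVq].
pose BN := B `&` N.
have oBN : open BN by exact: openI.
have nh q x : closed_set Q x -> nbhs Q (hitting (translate BN (- x)%R)).
  move=> Qx; apply: open_nbhs_nbhs; split.
    by apply: open_hitting; exact: open_translate.
  by exists x; split=> //; apply/translateE; rewrite subrr.
pose H q := hitting (translate BN (- q)%R) `&`
  \bigcap_(k in [set: 'I_r]) hitting (translate BN (- (q + g k))%R).
have nH : nbhs Q (\bigcap_(q in S Q A V) H q).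
  rewrite -[S Q A V]fset_setK//; apply: filter_bigI => q.
  rewrite in_fset_set// inE => -[[Qq Qg] _]; apply: filterI; first exact: nh.
  rewrite -[setT]fset_setK//; last exact: finite_finset.
  by apply: filter_bigI => k _; exact: nh.
have [Q' [[h Qh] HQ]] := hQ _ nH.
have hitPo q : hitting (translate BN (- q)%R) Q' -> exists x, Po (x + h)%R /\ BN (x - q)%R.
  by move=> [x []]; rewrite Qh => /translateE Px /translateE Bx; exists x.
(* [f q] is a point of [Q'] close to the occurrence [q]; off the occurrences the value 0 is a
   dummy. *)
have /choice[f Hf] q : exists x, S Q A V q -> Po (x + h)%R /\ BN (x - q)%R.
  have [/HQ[/hitPo[x Hx] _]|nSq] := pselect (S Q A V q); first by exists x.
  by exists 0%R.
exists h; apply: (@counting_le_inj R _ _ _ _ (fun q => (f q + h)%R)) => //.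
- apply: (finite_separated (U := U)).
  + exact: open_nbhs_nbhs.
  + by move=> p q [Pp _] [Pq _]; exact: sU.
  apply: translate_precompact => //; apply: precompact_setadd => //.
  apply: precompact_setsub => //.
  by apply: precompact_subset pN => x [].
- move=> q Sq; have [Pq Bq] := Hf q Sq; split; last first.
    apply/translateE; rewrite addrK; have [_ [a Aa [v Vv qE]]] := Sq.
    exists a => //; exists (f q - q - v)%R; first by exists (f q - q)%R => //; exists v.
    have aE : a = (q + v)%R by rewrite -qE subrK.
    by rewrite -(addrA (f q)) -opprD -aE addrCA subrr addr0.
  split=> // k _; apply/translateE.
  have [_ /(_ k I)/hitPo[y [Py By]]] := HQ q Sq.
  (* The points of [Q'] near [q] and near [q + g k] differ from [g k] by an element of [B - B],
     hence of [W], so their difference is exactly [g k]. *)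
  rewrite -(gW Pq Py) //.
  have /BUW[_] : setsub B B (y - (q + g k) - (f q - q))%R.
    by exists (y - (q + g k))%R; [case: By|exists (f q - q)%R => //; case: Bq].
  congr W.
  rewrite opprB opprD -addrA addrACA addNr add0r (addrC (- g k)%R) addrA.
  by rewrite (opprD (f q)) addrACA subrr addr0.
- move=> q q' Sq Sq' /addIr fqq; have [_ [Bq _]] := Hf q Sq; have [_ [Bq' _]] := Hf q' Sq'.
  apply: sQ; [by case: Sq => -[]|by case: Sq' => -[]|].
  have /BUW[+ _] : setsub B B (f q' - q' - (f q - q))%R.
    by exists (f q' - q')%R => //; exists (f q - q)%R.
  by rewrite fqq opprB addrC addrA subrK.
Qed.

(** A strong Folner sequence must exist, since the supremum over the empty set is [-oo]. *)
Lemma upper_density_ge0 P : (exists F, strong_folner m F) ->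
  0 <= upper_Banach_density m P.
Proof.
move=> [F sF]; apply: (@le_trans _ _ (limn_esup (fun n => counting (P `&` F n) / m (F n)))).
  apply: (@limn_esup_ge _ _ (cst 0%:E) 0%R); last exact: cvg_cst.
  move=> n; apply: mule_ge0; last by rewrite inve_ge0.
  by rewrite /counting; case: ifP => _; rewrite ?lee_fin ?leey.
by apply: ereal_sup_ubound; exists F.
Qed.

Lemma upper_bound (mu : probability (borel (closedSet G)) R) V :
  (forall (g : G) (A : set (borel (closedSet G))), measurable A ->
    mu (closed_act g @` A) = mu A) ->
  measurable (V : set (borel G)) -> precompact V -> setsub V V `<=` U -> V 0%R ->
  0 < m V -> (exists F, strong_folner m F) ->
  mu (sweep V pattern_section) <= m V * upper_Banach_density m pattern.
Proof.
move=> mu_inv mV pV VU V0 mV0 Fex; have [F sF] := Fex.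
have [hd lG cG] := hG; set K := sweep _ _; set d := upper_Banach_density _ _.
have mK : measurable (K : set (borel (closedSet G))).
  apply: (measurable_sweep hG oU U0 sU) => //; first exact: measurable_pattern_section.
  by move=> Q [].
have fV : m V \is a fin_num by rewrite ge0_fin_numE// haar_precompact.
have d0 : 0 <= d by exact: upper_density_ge0.
(* If the bound failed, the midpoint between its two sides would be a [c] contradicting [H]. *)
suff H (c : R) : (0 <= c)%R -> c%:E < mu K -> c%:E <= m V * d.
  rewrite leNgt; apply/negP => dK.
  have fK : mu K \is a fin_num by exact: fin_num_measure.
  have md0 : 0 <= m V * d by rewrite mule_ge0.
  have fd : m V * d \is a fin_num.
    by rewrite ge0_fin_numE// (lt_trans dK)// ltey_eq fK.
  have := H ((fine (m V * d) + fine (mu K)) / 2)%R.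
  rewrite -[m V * d in X in _ -> _ -> X]fineK// -[mu K in X in _ -> X -> _]fineK//.
  rewrite !lte_fin !lee_fin; move: dK; rewrite -[m V * d]fineK// -[mu K]fineK//= lte_fin.
  have := fine_ge0 md0; set x := fine _; set y := fine _.
  move=> x0 xy; have y2 : (0 <= (x + y) / 2)%R by lra.
  have y3 : ((x + y) / 2 < y)%R by lra.
  by move=> /(_ y2 y3); lra.
move=> c0 cK.
(* By Fubini the visits to [K] in [F n] have average measure [m (F n) * mu K], more than
   [c * m (F n)]. Outside the hull there are none, so some [Q] in the hull exceeds this bound. *)
have /choice[Q HQ] n : exists Q, hull Po Q /\
    c%:E * m (F n) < m (F n `&` [set x | K (closed_act x Q)]).
  apply: contrapT => /forallNP nQ; have [HF _ _] := sF; have [pF mF F0] := HF n.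
  have fF : m (F n) \is a fin_num by exact: strong_folner_fin.
  have : m (F n) * mu K <= m (F n) * c%:E; last first.
    by rewrite lee_pmul2l// leNgt cK.
  have cid : continuous (id : G -> G) by move=> x; exact: cvg_id.
  rewrite (haar_fubini hG hm mu_inv cid)//.
  rewrite muleC -[X in _ <= X]mule1 -(@probability_setT _ _ _ mu).
  rewrite -integral_cst//; apply: ge0_le_integral => //.
  - exact: measurable_fun_haar_slice.
  - move=> Q _; have [hQ|nhQ] := pselect (hull Po Q).
      by rewrite leNgt; apply/negP => lt; apply: (nQ Q).
    rewrite (_ : _ `&` _ = set0) ?measure0 ?mule_ge0//.
    rewrite -subset0 => x [_ /sweepE[v _ [+ _]]].
    by rewrite closed_actD => /(cross_section_actE hG)[].
have [V' [oV' V'0 pV' HV']] := pattern_approximation.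
have /choice[h Hh] n : exists h, counting (S (Q n) (F n) V) <=
    counting (pattern `&` translate (setadd (F n) (setsub V' V)) (- h)) :> \bar R.
  have [HF _ _] := sF; have [pF _ _] := HF n; have [hQ _] := HQ n.
  exact: HV'.
(* Thickening by [O] absorbs both the extent of [V] and the approximation error [V']. *)
pose O := setsub V' V.
have OE : O = setadd [set x | V (- x)%R] V'.
  apply/seteqP; split=> _ [a Va [b Vb <-]].
    by exists (- b)%R; [rewrite /= opprK|exists a => //; rewrite addrC].
  by exists b => //; exists (- a)%R => //; rewrite opprK addrC.
have oO : open O by rewrite OE; exact: open_setadd.
have O0 : O 0%R by exists 0%R => //; exists 0%R => //; rewrite subrr.
have pO : precompact O by exact: precompact_setsub.
pose F' := thicken F O (fun n => (- h n)%R).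
have sF' : strong_folner m (F' : nat -> set (borel G)) by exact: strong_folner_thicken.
have b0 : (0 < fine (m V))%R by rewrite fine_gt0// mV0 ltey_eq fV.
have cd : (c / fine (m V))%:E <= d.
  apply: (@le_trans _ _ (limn_esup (fun n => counting (pattern `&` F' n) / m (F' n)))); last first.
    by apply: ereal_sup_ubound; exists F'.
  apply: (@limn_esup_ge _ _ (fun n => (c / fine (m V))%:E * (m (F n) / m (F' n)))); last first.
    rewrite -[X in _ --> X]mule1; apply: cvgeZl => //.
    exact: (thicken_ratio hG hm (fun n => (- h n)%R) sF oO pO O0).
  move=> n; have [HF _ _] := sF'; have [pF' mF' F'0] := HF n.
  have [HF0 _ _] := sF; have [pF mF F0] := HF0 n.
  have fF' : m (F' n) \is a fin_num by exact: strong_folner_fin.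
  have fF : m (F n) \is a fin_num by exact: strong_folner_fin.
  have sP : unif_separated U pattern by move=> p q [Pp _] [Pq _]; exact: sU.
  have fP : finite_set (pattern `&` F' n).
    by apply: finite_separated sP _ => //; exact: open_nbhs_nbhs.
  have [hQ cS] := HQ n.
  have sQ : unif_separated U (Q n) by exact: hull_separated hQ.
  have pAV : precompact (setsub (F n) V) by exact: precompact_setsub.
  have fS : finite_set (S (Q n) (F n) V).
    apply: (@sub_finite_set _ _ (closed_set (Q n) `&` setsub (F n) V)).
      by move=> q [[Qq _] AVq].
    by apply: finite_separated sQ pAV; exact: open_nbhs_nbhs.
  have injS s s' v v' : S (Q n) (F n) V s -> S (Q n) (F n) V s' -> V v -> V v' ->
      (s + v = s' + v')%R -> s = s'.
    move=> [[Qs _] _] [[Qs' _] _] Vv Vv' E; apply: sQ => //; apply: VU.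
    exists v' => //; exists v => //.
    by rewrite -[v'](addKr s') -E addrA addrK addrC.
  have [mSV SV] := haar_setadd_finite hm fS mV injS.
  (* Visits lie in the disjoint translates [s + V] over occurrences [s], so their measure is at most
     the number of occurrences times [m V]. *)
  have le1 : c%:E * m (F n) <= counting (pattern `&` F' n) * m V.
    apply: (@le_trans _ _ (counting (S (Q n) (F n) V) * m V)); last first.
      by rewrite lee_pmul2r//; exact: Hh.
    rewrite -SV; apply: (le_trans (ltW cS)); apply: le_measure; rewrite ?inE//.
      apply: (measurable_slice cG (second_countable_closedSet hd lG cG)
        (psi := fun z => closed_act z.1 z.2)) => //.
      exact: closed_act_continuous.
    exact: slice_pattern.
  have fc : counting (pattern `&` F' n) \is a @fin_num R by rewrite /counting asboolT.
  rewrite !divE_fine// -EFinM lee_fin mulrA ler_pM2r ?invr_gt0 ?fine_gt0 ?F'0 ?ltey_eq ?fF'//.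
  rewrite mulrAC ler_pdivrMr//.
  by rewrite -(fineK fF) -(fineK fc) -(fineK fV) -!EFinM lee_fin in le1.
apply: le_trans (_ : m V * (c / fine (m V))%:E <= _); last by rewrite lee_pmul2l.
by rewrite -[X in X * _]fineK// -EFinM lee_fin mulrCA divff ?mulr1// gt_eqF.
Qed.

End UpperBound.

(** * Invariant measures of maximal transverse mass *)

Section InvariantMeasures.
Context {R : realType} {G : topologicalZmodType}.
Hypothesis hG : lcsc G.
Variable Po : set G.

(** The hull is closed, so its full mass is kept; the action is by homeomorphisms, so invariance is
    kept. *)
Lemma invariant_regularization (lam : set (borel (closedSet G)) -> R) :
  finitely_additive_probability lam ->
  (forall g (A : set (borel (closedSet G))), measurable A ->
    lam (closed_act g @^-1` A) = lam A) ->
  lam (hull Po) = 1 ->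
  exists mu : probability (borel (closedSet G)) R,
    invariant_probability_on (hull Po) mu /\
    forall K : set (closedSet G), closed K -> ((lam K)%:E <= mu K)%E.
Proof.
have [hd lG _] := hG; move=> fa lam_inv lam_hull.
have [mu [muK mu_inv]] := regularization (hausdorff_closedSet hd lG)
  (@compact_closedSet G) fa.
exists mu; split=> //; split.
  apply/eqP; rewrite eq_le (probability_le1 mu (measurable_hull Po)) /=.
  by rewrite -lam_hull; exact/muK/closed_hull.
move=> g A mA; rewrite closed_act_image.
apply: (mu_inv (closed_act (- g)) (closed_act g)) => //.
- exact: closed_act_continuousr.
- exact: closed_act_continuousr.
- by move=> P; rewrite closed_actNK.
- exact: closed_actK.
- by move=> B mB; exact: lam_inv.
Qed.

Lemma probability_finitely_additive d (T : measurableType d) (mu : probability T R) :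
  finitely_additive_probability (fun A => fine (mu A)).
Proof.
split=> [A mA||A B mA mB AB]; [exact: fine_ge0|by rewrite probability_setT|].
by rewrite measureU// fineD//; exact: fin_num_measure.
Qed.

(** Compactness of the set of invariant measures in the form used below: ultralimits exist up to
    regularization, and masses of closed sets are upper semicontinuous. *)
Lemma invariant_ultralimit (U : set_system nat) (mu : nat -> probability (borel (closedSet G)) R) :
  UltraFilter U -> (forall k, invariant_probability_on (hull Po) (mu k)) ->
  exists nu : probability (borel (closedSet G)) R,
    invariant_probability_on (hull Po) nu /\
    forall K : set (closedSet G), closed K ->
      lim (fine (mu k K) @[k --> U]) <= fine (nu K).
Proof.
move=> UU mu_inv.
have fa := finitely_additive_ultralimit (U := U)
  (fun k => probability_finitely_additive (mu k)).
have [||nu [nu_inv nuK]] := invariant_regularization (fa UU).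
- move=> g A mA; congr (lim (_ @ U)); apply/funext => k; congr fine.
  by apply: invariant_preimage => //; case: (mu_inv k).
- rewrite (_ : (fun k => _) = cst 1); first exact: lim_cst.
  by apply/funext => k; have [->] := mu_inv k.
exists nu; split=> // K cK; rewrite -lee_fin fineK; first exact: nuK.
by apply: fin_num_measure; exact: measurable_closed.
Qed.

End InvariantMeasures.

(** * Empirical measures along a strong Folner sequence *)

Section EmpiricalMeasures.
Context {R : realType} {G : topologicalZmodType}.
Hypothesis hG : lcsc G.
Variable m : {measure set (borel G) -> \bar R}.
Hypothesis hm : haar_measure m.
Variables (F : nat -> set G) (sF : strong_folner m (F : nat -> set (borel G))).
Implicit Types (B C Y : set G).

Let F_mes n : measurable (F n : set (borel G)).
Proof. by have [HF _ _] := sF; case: (HF n). Qed.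

Let F_fin n : m (F n) \is a fin_num.
Proof. exact: strong_folner_fin. Qed.

Let F_gt0 n : 0 < fine (m (F n)).
Proof.
have [HF _ _] := sF; have [_ _ F0] := HF n.
by rewrite fine_gt0// F0 ltey_eq F_fin.
Qed.

Definition density_in n (B : set G) : R := fine (m (F n `&` B)) / fine (m (F n)).

Definition folner_error C n : R := fine (mu_ext m (setadd (F n) C)) / fine (m (F n)) - 1.

Lemma folner_error_cvg C : compact C -> C !=set0 -> folner_error C n @[n --> \oo] --> 0.
Proof.
move=> cC C0; have [HF HC _] := sF; rewrite -(subrr 1); apply: cvgB; last exact: cvg_cst.
have [_] := (fine_cvgP _ _).1 (HC C cC C0); apply: cvg_trans.
apply: near_eq_cvg; apply: nearW => n /=.
have [hd _ _] := hG; have [pF _ _] := HF n.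
rewrite divE_fine//; last by have [_ _] := HF n.
by apply: (mu_ext_fin hm); apply: precompact_setadd => //; exact: compact_precompact.
Qed.

Lemma density_in_finitely_additive (f : G -> closedSet G) : continuous f -> forall n,
  finitely_additive_probability
    (fun A : set (borel (closedSet G)) => density_in n (f @^-1` A)).
Proof.
move=> cf n; have mf (A : set (borel (closedSet G))) : measurable A ->
    measurable (F n `&` f @^-1` A : set (borel G)).
  by move=> mA; apply: measurableI => //; exact: measurable_preimage.
have fin (A : set (borel (closedSet G))) : measurable A ->
    m (F n `&` f @^-1` A) \is a fin_num.
  move=> mA; rewrite ge0_fin_numE//; apply: le_lt_trans (_ : (m (F n) < +oo)%E).
    by apply: le_measure; rewrite ?inE//; exact: mf.
  by rewrite ltey_eq F_fin.
split=> [A mA||A B mA mB AB].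
- by rewrite /density_in divr_ge0// fine_ge0.
- by rewrite /density_in preimage_setT setIT divff//; exact: lt0r_neq0 (F_gt0 n).
- rewrite /density_in preimage_setU setIUr measureU; [|exact: mf|exact: mf|].
    by rewrite fineD ?fin// mulrDl.
  by rewrite setIACA setIid -preimage_setI AB preimage_set0 setI0.
Qed.

(** The part of [Y] outside [F n] lies in [F n + C], so its measure is at most the excess measured
    by [folner_error]. It is applied to a translate of [F n] and to the sum of [V] and the points of
    [Po] in [F n]. *)
Lemma density_in_le B Y C n : measurable (B : set (borel G)) ->
  measurable (Y : set (borel G)) -> compact C -> C 0 -> Y `<=` setadd (F n) C ->
  fine (m (Y `&` B)) / fine (m (F n)) <= density_in n B + folner_error C n.
Proof.
have [hd _ _] := hG; have [HF _ _] := sF; have [pF _ _] := HF n.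
move=> mB mY cC C0 YFC.
have pFC : precompact (setadd (F n) C).
  by apply: precompact_setadd => //; exact: compact_precompact.
have fin (A : set (borel G)) : measurable A -> A `<=` setadd (F n) C -> m A \is a fin_num.
  move=> mA AC; rewrite ge0_fin_numE// haar_precompact//.
  exact: (precompact_subset AC pFC).
have FFC : F n `<=` setadd (F n) C.
  by move=> x Fx; exists x => //; exists 0 => //; rewrite addr0.
have mD : measurable (Y `\` F n : set (borel G)) by exact: measurableD.
have mYB : measurable (Y `&` B : set (borel G)) by exact: measurableI.
have mFB : measurable (F n `&` B : set (borel G)) by exact: measurableI.
have DFC : Y `\` F n `<=` setadd (F n) C by move=> x [/YFC].
have FBFC : F n `&` B `<=` setadd (F n) C by move=> x [/FFC].
have eq1 : (m (F n `|` (Y `\` F n)) = m (F n) + m (Y `\` F n))%E.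
  by apply: measureU => //; rewrite setDIK.
have le1 : (m (F n) + m (Y `\` F n) <= mu_ext m (setadd (F n) C))%E.
  rewrite -eq1 -(measurable_mu_extE m); last exact: measurableU.
  by apply: le_mu_ext => // x [/FFC|/DFC].
have le2 : (m (Y `&` B) <= m (F n `&` B) + m (Y `\` F n))%E.
  apply: (@le_trans _ _ (m ((F n `&` B) `|` (Y `\` F n)))).
    apply: le_measure; rewrite ?inE//; first exact: measurableU.
    by move=> x [Yx Bx]; have [Fx|nFx] := pselect (F n x); [left|right].
  exact: measureU2.
have fe : mu_ext m (setadd (F n) C) \is a fin_num by exact: mu_ext_fin.
have f1 := fin _ (F_mes n) FFC; have f2 := fin _ mD DFC; have f3 := fin _ mFB FBFC.
have f4 : m (Y `&` B) \is a fin_num by apply: fin => // x [/YFC].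
have {}le1 : fine (m (F n)) + fine (m (Y `\` F n)) <= fine (mu_ext m (setadd (F n) C)).
  by rewrite -lee_fin EFinD !fineK.
have {}le2 : fine (m (Y `&` B)) <= fine (m (F n `&` B)) + fine (m (Y `\` F n)).
  by rewrite -lee_fin EFinD !fineK.
rewrite /density_in /folner_error.
rewrite -[X in _ <= _ + (_ - X)](divff (lt0r_neq0 (F_gt0 n))) -mulrBl -mulrDl.
rewrite ler_pM2r ?invr_gt0//; apply: le_trans le2 _.
by rewrite lerD2l lerBrDr addrC.
Qed.

Lemma ultra_eventually_cvg (U : set_system nat) (u : nat -> R) (l : R) :
  (forall N, U [set k | (N <= k)%N]) -> Filter U ->
  u n @[n --> \oo] --> l -> u n @[n --> U] --> l.
Proof.
move=> Uoo FU ul A nA; have [N _ HN] := ul A nA.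
by apply: (@filterS _ U FU _ _ HN); exact: Uoo.
Qed.

Lemma density_in01 n B : measurable (B : set (borel G)) -> 0 <= density_in n B <= 1.
Proof.
move=> mB; rewrite divr_ge0 ?fine_ge0//= ler_pdivrMr ?mul1r; last exact: F_gt0.
have le : (m (F n `&` B) <= m (F n))%E.
  by apply: le_measure; rewrite ?inE//; exact: measurableI.
by apply: fine_le => //; rewrite ge0_fin_numE// (le_lt_trans le)// ltey_eq F_fin.
Qed.

(** Translating by [g] changes [F n] only within [F n + {0, g}], with vanishing relative error. One
    inequality suffices, as it also holds for [- g]. *)
Lemma lim_density_in_shift (U : set_system nat) B g : UltraFilter U ->
  (forall N, U [set k | (N <= k)%N]) -> measurable (B : set (borel G)) ->
  lim (density_in n [set x | B (g + x)] @[n --> U]) <= lim (density_in n B @[n --> U]).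
Proof.
move=> UU Uoo mB.
have cC : compact ([set 0; g] : set G) by apply: compactU; exact: compact_set1.
have C0 : [set 0; g] (0 : G) by left.
have err : folner_error [set 0; g] n @[n --> U] --> 0.
  apply: ultra_eventually_cvg => //; apply: folner_error_cvg => //.
  by exists 0.
have mBg : measurable ([set x | B (g + x)] : set (borel G)).
  have := measurable_translate g mB; rewrite translate_preimage.
  by congr measurable; apply/seteqP; split=> x /=; rewrite addrC.
have cvB : cvg (density_in n B @[n --> U]).
  by apply: ultra_cvg => n; exact: density_in01.
rewrite -[leRHS]addr0 -(cvg_lim (@Rhausdorff R) err) -limD//; last first.
  by apply/cvg_ex; exists 0; exact: err.
apply: ler_lim.
- by apply: ultra_cvg => n; exact: density_in01.
- by apply: is_cvgD => //; apply/cvg_ex; exists 0; exact: err.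
apply: nearW => n; pose Y := [set x | F n (x - g)].
have mY : measurable (Y : set (borel G)).
  by have := measurable_translate (- g) (F_mes n); rewrite translate_preimage.
have YC : Y `<=` setadd (F n) [set 0; g].
  by move=> x Yx; exists (x - g) => //; exists g; [right|rewrite subrK].
apply: le_trans (density_in_le mB mY cC C0 YC).
rewrite -(haar_shift hm g (measurableI _ _ mY mB)).
suff -> : [set x | (Y `&` B) (x + g)] = F n `&` [set x | B (g + x)] by [].
by apply/seteqP; split=> x; rewrite /Y /= addrK addrC.
Qed.

End EmpiricalMeasures.


Section MaximalMeasure.
Context {R : realType} {G : topologicalZmodType}.
Hypothesis hG : lcsc G.
Variable m : {measure set (borel G) -> \bar R}.
Hypothesis hm : haar_measure m.
Variables (Po U V : set G).
Hypotheses (cPo : closed Po) (oU : open U) (U0 : U 0) (sU : unif_separated U Po).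
Hypotheses (cV : compact V) (VU : setsub V V `<=` U) (V0 : V 0) (mV0 : (0 < m V)%E).

Let mV : measurable (V : set (borel G)).
Proof. by have [hd _ _] := hG; apply: measurable_closed; exact: compact_closed. Qed.

Let pV : precompact V.
Proof. by have [hd _ _] := hG; exact: compact_precompact. Qed.

Let fV : m V \is a fin_num.
Proof. by rewrite ge0_fin_numE// haar_precompact. Qed.

Let V_gt0 : 0 < fine (m V).
Proof. by rewrite fine_gt0// mV0 ltey_eq fV. Qed.

(** For compact [V] the sweep is the closed hull minus an open set of the form [avoiding].
    Regularization can therefore only increase its mass. *)
Lemma sweep_cross_section_closed : closed (sweep V (cross_section Po)).
Proof.
rewrite (sweep_cross_section hG); apply: closedI; first exact: closed_hull.
have -> : hitting [set x | V (- x)] = ~` avoiding [set x | V (- x)].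
  apply/seteqP; split=> Q /=.
    by move=> [x [Qx Vx]]; apply/notin_avoiding; exists x.
  by move=> /notin_avoiding[x Qx Vx]; exists x.
apply: open_closedC; apply: open_avoiding.
have -> : [set x | V (- x)] = -%R @` V.
  by apply/seteqP; split=> [x Vx|_ [v Vv <-]]; [exists (- x); rewrite ?opprK|rewrite /= opprK].
exact: compact_opp.
Qed.

Lemma exists_measure_gt (c : R) : (c%:E < upper_Banach_density m Po)%E ->
  exists mu : probability (borel (closedSet G)) R,
    invariant_probability_on (hull Po) mu /\
    c * fine (m V) <= fine (mu (sweep V (cross_section Po))).
Proof.
have [hd lG _] := hG.
move=> /ereal_sup_gt[_ [F sF <-] cF].
have [HF _ _] := sF; pose u n := (counting (Po `&` F n) / m (F n))%E.
pose D := [set n | (c%:E < u n)%E].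
(* As the limit superior exceeds [c], the set [D] meets every tail; an ultrafilter containing [D]
   and all tails keeps the ratio above [c]. *)
have PF : ProperFilter (filter_from [set: nat] (fun N => D `&` [set n | (N <= n)%N])).
  apply: filter_from_proper; last by move=> N _; have [n Nn cn] := limn_esup_gt N cF; exists n.
  apply: filter_from_filter; first by exists 0%N.
  move=> i j _ _; exists (maxn i j) => // n [Dn]; rewrite /= geq_max => /andP[? ?].
  by split.
have [W [UW sW]] := ultraFilterLemma PF.
have Woo N : W [set k | (N <= k)%N] by apply: sW; exists N => // n [].
have WD : W D by apply: sW; exists 0%N => // n [].
pose P := ClosedSet cPo.
pose f (x : G) := closed_act x P.
have cf : continuous f by exact: closed_act_continuousl.
have fhull x : hull Po (f x).
  by apply: hull_act => //; apply: subset_closure; exists 0; apply/seteqP; split=> y;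
    rewrite translateE addr0.
have mf (A : set (closedSet G)) : measurable (A : set (borel (closedSet G))) ->
  measurable (f @^-1` A : set (borel G)) by exact: measurable_preimage.
pose lam (A : set (borel (closedSet G))) := lim (density_in m F n (f @^-1` A) @[n --> W]).
have fa : finitely_additive_probability lam.
  exact: (@finitely_additive_ultralimit R W UW _ (borel (closedSet G))
    (fun n A => density_in m F n (f @^-1` A))
    (density_in_finitely_additive hm sF cf)).
have lam_le g (A : set (borel (closedSet G))) : measurable A ->
    lam (closed_act g @^-1` A) <= lam A.
  move=> mA; have := lim_density_in_shift hG hm sF g UW Woo (mf _ mA).
  rewrite /lam; congr (lim (_ @ W) <= _); apply/funext => n; congr density_in.
  by apply/seteqP; split=> x /=; rewrite /f closed_actD.
have [||mu [mu_inv muK]] := invariant_regularization hG (Po := Po) fa.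
- move=> g A mA; apply/eqP; rewrite eq_le lam_le//=.
  have mgA : measurable (closed_act g @^-1` A : set (borel (closedSet G))).
    by apply: measurable_preimage => //; exact: closed_act_continuousr.
  have := lam_le (- g) _ mgA; rewrite (_ : _ @^-1` (_ @^-1` A) = A)//.
  by apply/seteqP; split=> Q /=; rewrite closed_actNK.
- have [_ <- _] := fa; rewrite /lam; congr (lim (_ @ W)); apply/funext => n.
  by congr density_in; apply/seteqP; split=> x // _; exact: fhull.
exists mu; split=> //; set K := sweep V _.
have cK : closed K by exact: sweep_cross_section_closed.
rewrite -lee_fin fineK; last by apply: fin_num_measure; exact: measurable_closed.
apply: le_trans (muK _ cK); rewrite lee_fin.
have mB : measurable (f @^-1` K : set (borel G)) by apply: mf; exact: measurable_closed.
have cvB : cvg (density_in m F n (f @^-1` K) @[n --> W]).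
  by apply: ultra_cvg => n; exact: density_in01.
have err : folner_error m F V n @[n --> W] --> 0.
  apply: ultra_eventually_cvg => //; apply: folner_error_cvg => //.
  by exists 0.
rewrite /lam -[leRHS]addr0 -(cvg_lim (@Rhausdorff R) err) -limD//; last first.
  by apply/cvg_ex; exists 0; exact: err.
apply: limr_ge; first by apply: is_cvgD => //; apply/cvg_ex; exists 0; exact: err.
apply: filterS WD => n cn; have [pF mF F0] := HF n.
have fF : m (F n) \is a fin_num by exact: strong_folner_fin.
have rF0 : 0 < fine (m (F n)) by rewrite fine_gt0// F0 ltey_eq fF.
have fS : finite_set (Po `&` F n).
  by apply: finite_separated sU pF; exact: open_nbhs_nbhs.
have fc : counting (Po `&` F n) \is a @fin_num R by rewrite /counting asboolT.
have inj s s' v v' : (Po `&` F n) s -> (Po `&` F n) s' -> V v -> V v' ->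
    s + v = s' + v' -> s = s'.
  move=> [Ps _] [Ps' _] Vv Vv' E; apply: sU => //; apply: VU.
  exists v' => //; exists v => //.
  by rewrite -[v'](addKr s') -E addrA addrK addrC.
have [mY mYE] := haar_setadd_finite hm fS mV inj.
have YFV : setadd (Po `&` F n) V `<=` setadd (F n) V.
  by move=> _ [s [_ Fs] [v Vv <-]]; exists s => //; exists v.
have := density_in_le hG hm sF mB mY cV V0 YFV.
(* For [s] in [Po] the translate by [s] contains 0, so at time [s + v] the orbit of [Po] is in [K]:
   all of this set consists of visits, and its measure is the count times [m V]. *)
have -> : setadd (Po `&` F n) V `&` (f @^-1` K) = setadd (Po `&` F n) V.
  apply/setIidPl => _ [s [Ps _] [v Vv <-]]; apply/(sweepE V).
  exists v => //; rewrite /f closed_actD; apply/(cross_section_actE hG); split.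
    by apply: subset_closure; exists 0; apply/seteqP; split=> y; rewrite translateE addr0.
  by rewrite addrC addrK.
apply: le_trans; rewrite mYE fineM// mulrAC ler_pM2r//.
by move: cn; rewrite /D /= /u divE_fine// lte_fin => /ltW.
Qed.

Hypothesis d_gt0 : (0 < upper_Banach_density m Po)%E.

Lemma exists_folner : exists F, strong_folner m F.
Proof.
by have /ereal_sup_gt[_ [F sF _] _] := d_gt0; exists F.
Qed.

Lemma sweep_le_density mu : invariant_probability_on (hull Po) mu ->
  (mu (sweep V (cross_section Po)) <= m V * upper_Banach_density m Po)%E.
Proof.
move=> [_ mu_inv].
(* The empty pattern: its occurrences are all points of [Po], its section is the whole
   cross-section, and [W] may be the whole group. *)
pose g (k : 'I_0) : G := 0.
have := @upper_bound R G hG m hm Po U setT 0 g oU U0 sU openT I _ mu V mu_inv mV pV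
  VU V0 mV0 exists_folner.
have -> : pattern Po g = Po.
  by apply/seteqP; split=> [x []//|x Px]; split=> // -[].
have -> : pattern_section Po g = cross_section Po.
  by apply/seteqP; split=> [x []//|x Px]; split=> // -[].
by apply => -[].
Qed.

(** An infinite density would allow [c = 2 / m V] in [exists_measure_gt], giving a set of
    probability at least 2. *)
Lemma density_fin : upper_Banach_density m Po \is a fin_num.
Proof.
rewrite ge0_fin_numE ?ltW// ltey; apply/eqP => dy.
have [|mu [_]] := @exists_measure_gt (2 / fine (m V)); first by rewrite dy ltry.
rewrite mulrVK ?unitfE ?gt_eqF// leNgt => /negP; apply.
apply: (@le_lt_trans _ _ 1); last by rewrite ltr1n.
rewrite -lee_fin fineK.
  by apply: probability_le1; apply: measurable_closed; exact: sweep_cross_section_closed.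
by apply: fin_num_measure; apply: measurable_closed; exact: sweep_cross_section_closed.
Qed.

Let d : R := fine (upper_Banach_density m Po).

(** An ultralimit of invariant measures with masses approaching the bound attains it, because the
    sweep is closed. *)
Lemma exists_maximal_measure (W : set_system nat) : UltraFilter W ->
  (forall N, W [set k | (N <= k)%N]) ->
  exists mu : probability (borel (closedSet G)) R,
    invariant_probability_on (hull Po) mu /\
    d * fine (m V) <= fine (mu (sweep V (cross_section Po))).
Proof.
move=> UW Woo.
have /choice[mu Hmu] k : exists mu : probability (borel (closedSet G)) R,
    invariant_probability_on (hull Po) mu /\
    (d - k.+1%:R^-1) * fine (m V) <= fine (mu (sweep V (cross_section Po))).
  apply: exists_measure_gt; rewrite -[ltRHS]fineK ?density_fin// lte_fin.
  by rewrite ltrBlDr ltrDl invr_gt0.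
have [|nu [nu_inv nuK]] := invariant_ultralimit hG UW (Po := Po) (mu := mu).
  by move=> k; case: (Hmu k).
exists nu; split=> //.
apply: le_trans (nuK _ sweep_cross_section_closed).
have mK : measurable (sweep V (cross_section Po) : set (borel (closedSet G))).
  by apply: measurable_closed; exact: sweep_cross_section_closed.
have cv : cvg (fine (mu k (sweep V (cross_section Po))) @[k --> W]).
  apply: ultra_cvg => k; rewrite fine_ge0//= -lee_fin fineK ?probability_le1//.
  exact: fin_num_measure.
apply/ler_addgt0Pr => e e0; rewrite -lerBlDr.
apply: limr_ge => //.
have eV : 0 < e / fine (m V) by rewrite divr_gt0.
have [N _ HN] := near_infty_natSinv_lt (PosNum eV).
apply: filterS (Woo N) => k Nk; have [_] := Hmu k; apply: le_trans.
rewrite mulrBl lerD2l lerN2 -ler_pdivlMr//.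
by have /ltW := HN k Nk.
Qed.

End MaximalMeasure.

(** * Ergodic measures *)

(** The complements of finite unions of basic open sets are closed, countably many, stable under
    intersection and generate the Borel sets, so probabilities agreeing on them are equal. *)
Lemma separating_closed_sets (R : realType) (X : ptopologicalType) :
  @second_countable X -> exists K : nat -> set X, (forall n, closed (K n)) /\
    forall mu nu : probability (borel X) R, (forall n, mu (K n) = nu (K n)) ->
      forall A : set (borel X), measurable A -> mu A = nu A.
Proof.
move=> [B cB [oB Bx]].
move: cB => /pfcard_geP[B0|[f]].
  by have [b [+ _] _] := Bx point setT filterT; rewrite B0.
pose K (s : seq nat) : set X := [set x | forall j, j \in s -> ~ f j x].
have cK s : closed (K s).
  have -> : K s = \bigcap_(j in [set j | j \in s]) (~` f j) by [].
  by apply: closed_bigI => j _; apply: open_closedC; apply: oB; exact: funS.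
(* Finite lists of indices are enumerated by their codes; a number that codes no list gives [K
   [::]], the whole space. *)
pose k n := K (odflt [::] (choice.unpickle n)); exists k; split=> [n|mu nu mn]; first exact: cK.
have KE s : K s = k (choice.pickle s) by rewrite /k choice.pickleK.
move=> A mA; apply: (@measure_unique _ R (borel X) (range k) (fun=> setT) _ _ _ _ mu nu) => //.
- rewrite eqEsubset; split; last first.
    apply: smallest_sub; first exact: sigma_algebra_measurable.
    by move=> _ [n _ <-]; apply: measurable_closed; exact: cK.
  apply: smallest_sub; first exact: smallest_sigma_algebra.
  move=> U oU; pose D := [set n | f n `<=` U].
  have -> : U = \bigcup_n (if n \in D then f n else set0).
    apply/seteqP; split=> [x Ux|x [n _]]; last by case: ifPn => //; rewrite inE; exact.
    have [b [Bb bx] /= bU] := Bx x _ (open_nbhs_nbhs (conj oU Ux)).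
    have [n _ fn] := @surj _ _ _ _ f _ Bb.
    by exists n => //; rewrite mem_set ?fn// /D /= fn.
  apply: sigma_algebra_bigcup => n; case: ifPn => _; last exact: sigma_algebra0.
  rewrite (_ : f n = setT `\` K [:: n]).
    by apply: sigma_algebraCD; apply: sub_sigma_algebra; exists (choice.pickle [:: n]).
  apply/seteqP; split=> x.
    by move=> fx; split=> // /(_ n); rewrite inE eqxx => /(_ isT).
  move=> [_ nK]; apply: contrapT => nf; apply: nK => j.
  by rewrite inE => /eqP ->.
- move=> _ _ [i _ <-] [j _ <-]; rewrite /k.
  set s := odflt _ _; set t := odflt _ _.
  exists (choice.pickle (s ++ t)) => //; rewrite choice.pickleK /=; apply/seteqP; split=> x.
    by move=> H; split=> l ls; apply: H; rewrite mem_cat ls ?orbT.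
  by move=> [Hs Ht] l; rewrite mem_cat => /orP[/Hs|/Ht].
- by move=> _; exists (choice.pickle ([::] : seq nat)) => //; rewrite -KE; apply/seteqP; split.
- by apply/seteqP; split=> // x _; exists 0%N.
- by move=> _ [n _ <-]; exact: mn.
- by move=> _; rewrite /= probability_setT ltry.
Qed.

Section Conditioning.
Local Open Scope ereal_scope.
Context {R : realType} d (T : measurableType d) (mu : probability T R).
Variables (A : set T) (mA : measurable A) (A0 : mu A != 0).

(** The last [mu] is the default of the normalization, taken when the restriction has mass zero;
    [A0] excludes this case in [conditionalE]. *)
Definition conditional : probability T R := mnormalize (mrestr mu mA) mu.

Lemma conditionalE B : measurable B ->
  conditional B = (fine (mu (B `&` A)) / fine (mu A))%:E.
Proof.
move=> mB; rewrite /conditional /= /mnormalize /= /mrestr setTI (negbTE A0) /=.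
have fA : mu A \is a fin_num by exact: fin_num_measure.
rewrite ifF; last by apply/negP => /eqP E; rewrite E in fA.
by rewrite EFinM fineK// fin_num_measure//; exact: measurableI.
Qed.

End Conditioning.

Section ExtremeMeasure.
Context {R : realType} {G : topologicalZmodType}.
Hypothesis hG : lcsc G.
Variable Po : set G.

Lemma conditional_invariant (mu : probability (borel (closedSet G)) R)
    (A : set (borel (closedSet G))) (mA : measurable A) (A0 : (mu A != 0)%E) :
  invariant_probability_on (hull Po) mu -> (forall g, closed_act g @` A = A) ->
  invariant_probability_on (hull Po) (conditional mu mA).
Proof.
have [hd lG _] := hG; move=> [mu1 mu_inv] A_inv; have mh := measurable_hull Po.
have fA : mu A \is a fin_num by exact: fin_num_measure.
have pA : fine (mu A) != 0 by rewrite fine_eq0.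
split.
  rewrite conditionalE// (_ : mu (hull Po `&` A) = mu A) ?divff//.
  have mAh : measurable (A `\` hull Po) by exact: measurableD.
  have mhA : measurable (hull Po `&` A : set (borel (closedSet G))) by exact: measurableI.
  have Dz : mu (A `\` hull Po) = 0%E.
    apply/eqP; rewrite eq_le measure_ge0 andbT.
    apply: (@le_trans _ _ (mu (~` hull Po))).
      by apply: le_measure; rewrite ?inE//; exact: measurableC.
    by rewrite probability_setC// mu1 subee.
  by rewrite [RHS](measureDI mu mA mh) [X in (X + _)%E]Dz add0e setIC.
move=> g B mB; rewrite !conditionalE//; last first.
  by rewrite closed_act_image; apply: measurable_preimage => //; exact: closed_act_continuousr.
suff -> : closed_act g @` B `&` A = closed_act g @` (B `&` A).
  by rewrite mu_inv//; exact: measurableI.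
rewrite -{1}(A_inv g); apply/seteqP; split=> Q.
  move=> [[P BP <-] [P' AP' E]]; exists P => //; split=> //.
  by rewrite -(closed_actK g P) -E closed_actK.
by move=> [P [BP AP] <-]; split; exists P.
Qed.

End ExtremeMeasure.

Section ErgodicMeasure.
Context {R : realType} {G : topologicalZmodType}.
Hypothesis hG : lcsc G.
Variable m : {measure set (borel G) -> \bar R}.
Hypothesis hm : haar_measure m.
Variables (Po U V : set G).
Hypotheses (cPo : closed Po) (oU : open U) (U0 : U 0) (sU : unif_separated U Po).
Hypotheses (cV : compact V) (VU : setsub V V `<=` U) (V0 : V 0) (mV0 : (0 < m V)%E).
Hypothesis d_gt0 : (0 < upper_Banach_density m Po)%E.

Let K0 := sweep V (cross_section Po).
Let c := fine (upper_Banach_density m Po) * fine (m V).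

Let mV : measurable (V : set (borel G)).
Proof. by have [hd _ _] := hG; apply: measurable_closed; exact: compact_closed. Qed.

Let fV : m V \is a fin_num.
Proof.
by have [hd _ _] := hG; rewrite ge0_fin_numE// haar_precompact//; exact: compact_precompact.
Qed.

Let cK0 : closed K0.
Proof. exact: sweep_cross_section_closed. Qed.

Let mK0 : measurable (K0 : set (borel (closedSet G))).
Proof. exact: measurable_closed. Qed.

Let K0_le (mu : probability (borel (closedSet G)) R) :
  invariant_probability_on (hull Po) mu -> fine (mu K0) <= c.
Proof.
move=> mu_inv.
have fd := density_fin hG hm cPo oU U0 sU cV VU V0 mV0 d_gt0.
have := sweep_le_density hG hm oU U0 sU cV VU V0 mV0 d_gt0 mu_inv.
rewrite -/K0 /c -[X in (_ <= X * _)%E]fineK// -[X in (_ <= _ * X)%E]fineK//.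
rewrite -EFinM mulrC -[X in (X <= _)%E]fineK ?lee_fin//.
exact: fin_num_measure.
Qed.

(** An extreme point among the invariant measures of maximal mass is ergodic, since conditioning on
    an invariant set and on its complement stays within this class. *)
Lemma exists_ergodic_measure : exists mu : probability (borel (closedSet G)) R,
  [/\ invariant_probability_on (hull Po) mu,
      forall A : set (borel (closedSet G)), measurable A ->
        (forall g, closed_act g @` A = A) -> mu A = 0%E \/ mu A = 1%E &
      fine (mu (sweep V (cross_section Po))) =
        fine (upper_Banach_density m Po) * fine (m V)].
Proof.
have [hd lG cG] := hG.
have [W [UW sW]] : exists W, UltraFilter W /\ \oo `<=` W by exact: ultraFilterLemma.
have Woo N : W [set k | (N <= k)%N] by apply: sW; exact: nbhs_infty_ge.
have [K [cK sepK]] := separating_closed_sets R (second_countable_closedSet hd lG cG).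
have mK n : measurable (K n : set (borel (closedSet G))) by exact: measurable_closed.
have p01 (mu : probability (borel (closedSet G)) R) (A : set (borel (closedSet G))) :
    measurable A -> 0 <= fine (mu A) <= 1.
  move=> mA; rewrite fine_ge0//= -lee_fin fineK ?probability_le1//.
  exact: fin_num_measure.
(* A measure of maximal mass is recorded by its values on the separating closed sets, which
   ultralimits can only increase, as [exists_extreme] demands. *)
pose M : set (nat -> R) := [set a | exists mu : probability (borel (closedSet G)) R,
  [/\ invariant_probability_on (hull Po) mu, c <= fine (mu K0) &
      forall n, a n = fine (mu (K n))]].
have [|||a [mu [mu_inv mu_c aE]] a_ext] := @exists_extreme R W UW Woo M.
- have [mu [mu_inv mu_c]] :=
    exists_maximal_measure hG hm cPo oU U0 sU cV VU V0 mV0 d_gt0 UW Woo.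
  by exists (fun n => fine (mu (K n))), mu.
- by move=> a [mu [_ _ aE]] n; rewrite aE; exact: p01.
- move=> s sM; have /choice[mu Hmu] k := sM k.
  have [|nu [nu_inv nuK]] := invariant_ultralimit hG UW (Po := Po) (mu := mu).
    by move=> k; case: (Hmu k).
  exists (fun n => fine (nu (K n))).
    exists nu; split=> //; apply: le_trans (nuK _ cK0); apply: limr_ge.
      by apply: ultra_cvg => k; exact: p01.
    by apply: nearW => k; case: (Hmu k).
  move=> n; apply: le_trans (nuK _ (cK n)).
  rewrite (_ : s^~ n = fun k => fine (mu k (K n)))//.
  by apply/funext => k; case: (Hmu k).
exists mu; split=> //; last by apply/eqP; rewrite eq_le -/c mu_c K0_le.
move=> A mA A_inv.
have [->|A0] := eqVneq (mu A) 0%E; first by left.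
have [->|A1] := eqVneq (mu A) 1%E; first by right.
exfalso; have mAC : measurable (~` A) by exact: measurableC.
have fA : mu A \is a fin_num by exact: fin_num_measure.
have AC0 : mu (~` A) != 0%E.
  rewrite probability_setC// -[mu A]fineK// -EFinB eqe subr_eq0 eq_sym.
  by apply: contra A1 => /eqP A1; rewrite -[mu A]fineK// A1.
have AC_inv g : closed_act g @` (~` A) = ~` A.
  have := A_inv g; rewrite !closed_act_image => E.
  by rewrite -preimage_setC E.
(* If [mu A] is neither 0 nor 1, then [mu] is a proper convex combination of these two invariant
   measures. *)
pose mu1 := conditional mu mA; pose mu2 := conditional mu mAC.
have mu1_inv : invariant_probability_on (hull Po) mu1 by exact: conditional_invariant.
have mu2_inv : invariant_probability_on (hull Po) mu2 by exact: conditional_invariant.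
pose p := fine (mu A).
have pE : fine (mu (~` A)) = 1 - p by rewrite probability_setC// fineB.
have p0 : 0 < p.
  by rewrite lt_neqAle eq_sym fine_eq0// A0; have /andP[] := p01 mu A mA.
have p1 : p < 1.
  have /andP[_ p1] := p01 mu A mA; rewrite lt_neqAle p1 andbT.
  by apply: contra A1 => /eqP pA1; rewrite -[mu A]fineK// -/p pA1.
have dec (B : set (borel (closedSet G))) : measurable B ->
    fine (mu B) = p * fine (mu1 B) + (1 - p) * fine (mu2 B).
  have mulK (x q : R) : 0 < q -> q * (x / q) = x.
    by move=> q0; rewrite mulrCA divff ?mulr1// gt_eqF.
  move=> mB; rewrite !conditionalE//= pE !mulK ?subr_gt0//.
  rewrite -fineD ?fin_num_measure//; try exact: measurableI.
  by rewrite [in LHS](measureDI mu mB mA) addeC setDE.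
have := dec _ mK0; have := K0_le mu1_inv; have := K0_le mu2_inv.
set x := fine (mu1 K0); set y := fine (mu2 K0); set z := fine (mu K0).
move=> yc xc zE.
(* Neither mass exceeds [c] while their weighted mean is at least [c], so both conditionals are
   again maximal. *)
have [cx cy] : c <= x /\ c <= y.
  have q0 : 0 < 1 - p by rewrite subr_gt0.
  have zc : c <= z by [].
  split; rewrite leNgt; apply/negP => lt.
    have : p * x < p * c by rewrite ltr_pM2l.
    have : (1 - p) * y <= (1 - p) * c by rewrite ler_pM2l.
    by move: zc; rewrite zE; lra.
  have : p * x <= p * c by rewrite ler_pM2l.
  have : (1 - p) * y < (1 - p) * c by rewrite ltr_pM2l.
  by move: zc; rewrite zE; lra.
have eqK n : fine (mu1 (K n)) = fine (mu2 (K n)).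
  apply: (a_ext (fun n => fine (mu1 (K n))) (fun n => fine (mu2 (K n))) p).
  - by exists mu1.
  - by exists mu2.
  - by rewrite p0.
  - by move=> k; rewrite aE; exact: dec.
(* Extremality identifies the two conditionals, although they give [A] the masses 1 and 0. *)
have : mu1 A = mu2 A.
  apply: sepK => // n; rewrite -[LHS]fineK ?fin_num_measure// eqK fineK//.
  exact: fin_num_measure.
rewrite !conditionalE// setIid setICr measure0 /= mul0r divff ?gt_eqF//.
by move=> /eqP; rewrite eqe oner_eq0.
Qed.

End ErgodicMeasure.

(** * The punctured hull and the assembly of the proof *)

Lemma punctured_hull_act (G : topologicalZmodType) (hG : lcsc G) (Po : set G) (g : G) :
  closed_act g @` punctured_hull Po = punctured_hull Po.
Proof.
have sub h : closed_act h @` punctured_hull Po `<=` punctured_hull Po.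
  move=> _ [Q [hQ nQ] <-]; split; first exact/(hull_actE hG).
  move=> gQ0; apply: nQ => /=; rewrite -subset0 => x Qx.
  have : closed_set (closed_act h Q) (x - h) by apply/closed_actE; rewrite subrK.
  by rewrite gQ0.
apply/seteqP; split; first exact: sub.
move=> Q hQ; exists (closed_act (- g) Q); last exact: closed_actNK.
by apply: (sub (- g)); exists Q.
Qed.


Theorem theorem3p1 (R : realType) (G : topologicalZmodType) (hG : lcsc G)
    (m : {measure set (borel G) -> \bar R}) (hm : haar_measure m)
    (Po : set G) (hPo : unif_discrete Po)
    (hdPo : (0 < upper_Banach_density m Po)%E)
    (Delta : set G) (hDelta0 : Delta 0)
    (hDelta : exists W : set G, [/\ open W, W 0 &
      setsub (closure (setsub Po Po)) Delta `&` W = [set 0]]) :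
  exists (mu : probability (borel (closedSet G)) R)
         (nu : {finite_measure set (borel (closedSet G)) -> \bar R}),
    [/\ invariant_probability_on (punctured_hull Po) mu,
        ergodic_on (punctured_hull Po) mu,
        is_transverse_measure m Po mu nu,
        upper_Banach_density m Po = nu (cross_section Po) &
        forall (r : nat) (g : 'I_r -> G), (1 <= r)%N ->
          (forall k, Delta (g k)) ->
          (nu (\bigcap_k (closed_act (- g k)%R @` cross_section Po)) <=
           upper_Banach_density m (Po `&` \bigcap_k translate Po (g k)))%E].
Proof.
have [hd lG cG] := hG; have cPo := unif_discrete_closed hd hPo.
have [U' nU' U'P] := hPo; pose U : set G := U'°.
have oU : open U by exact: open_interior.
have U0 : U 0 by exact: nU'.
have sU : unif_separated U Po.
  move=> p q Pp Pq Upq; apply: (unif_discrete_for_inj U'P) => //.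
  exact: interior_subset.
have [N [oN N0 NU]] := nbhs_sub0 (open_nbhs_nbhs (conj oU U0)).
have [V [nV cV clV VN]] := locally_compact_nbhs hd lG (open_nbhs_nbhs (conj oN N0)).
have V0 : V 0 by exact: nbhs_singleton.
have VU : setsub V V `<=` U.
  by move=> _ [v /VN Nv [w /VN Nw <-]]; apply: NU; exists v => //; exists w.
have mV : measurable (V : set (borel G)) by exact: measurable_closed.
have pV : precompact V by exact: compact_precompact.
have mV0 : (0 < m V)%E.
  have [_ pos _] := hm; apply: (@lt_le_trans _ _ (m V°)).
    by apply: pos; [exact: open_interior|exists 0].
  apply: le_measure; rewrite ?inE//; last exact: interior_subset.
  by apply: measurable_open; exact: open_interior.
have fV : m V \is a fin_num by rewrite ge0_fin_numE// haar_precompact.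
have fd := density_fin hG hm cPo oU U0 sU cV VU V0 mV0 hdPo.
have [mu [mu_inv mu_erg mu_max]] :=
  exists_ergodic_measure hG hm cPo oU U0 sU cV VU V0 mV0 hdPo.
have [mu_hull mu_act] := mu_inv.
pose nu := transverse_measure hG m oU U0 sU mV VU mu.
have nuE (B : set (closedSet G)) : B `<=` cross_section Po ->
    (m V * nu B = mu (sweep V B))%E by move=> BT; exact: transverse_measureE.
have mK : measurable (sweep V (cross_section Po) : set (borel (closedSet G))).
  by apply: measurable_closed; exact: sweep_cross_section_closed.
have muK : (mu (sweep V (cross_section Po)) = m V * upper_Banach_density m Po)%E.
  rewrite -[LHS]fineK ?mu_max; last exact: fin_num_measure.
  by rewrite EFinM !fineK// muleC.
have cancel_m (x y : \bar R) : (m V * x <= m V * y)%E -> (x <= y)%E.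
  by rewrite lee_pmul2l.
have nuT : upper_Banach_density m Po = nu (cross_section Po).
  have nuTE : (m V * nu (cross_section Po) = m V * upper_Banach_density m Po)%E.
    by rewrite nuE.
  by apply/eqP; rewrite eq_le; apply/andP; split; apply: cancel_m; rewrite nuTE.
have mph : measurable (punctured_hull Po : set (borel (closedSet G))).
  rewrite (_ : punctured_hull Po = hull Po `&` hitting setT).
    apply: measurableI; first exact: measurable_hull.
    by apply: measurable_open; apply: open_hitting; exact: openT.
  apply/seteqP; split=> Q [hQ Q0]; split=> //.
    by have /eqP/set0P[x Qx] := Q0; exists x.
  by case: Q0 => x [Qx _] /= QE; rewrite QE in Qx.
exists mu, nu; split.
- split; last exact: mu_act.
  (* The punctured hull is invariant, so its mass is 0 or 1; it contains the sweep of the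
     cross-section, whose mass [m V] times the density is positive. *)
  have [ph0|//] := mu_erg _ mph (punctured_hull_act hG Po).
  exfalso; have : (mu (sweep V (cross_section Po)) <= 0)%E.
    rewrite -ph0; apply: le_measure; rewrite ?inE// => Q /sweepE[v _ TQ].
    move: TQ => /(cross_section_actE hG)[hQ Qv].
    by split=> //= Q0; rewrite Q0 in Qv.
  by rewrite muK leNgt mule_gt0.
- by move=> A mA _; exact: mu_erg.
- exact: (is_transverse_transverse_measure hG hm oU U0 sU mV VU pV mV0 mu_act).
- exact: nuT.
move=> r g _ gD; have [W [oW W0 WD]] := hDelta.
(* The assumption on [Delta] enters here: a difference of points of [Po] that is [W]-close to [g k]
   equals [g k]. *)
have gW k p p' : Po p -> Po p' -> W (p' - p - g k) -> p' = p + g k.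
  move=> Pp Pp' Wp; have : [set 0] (p' - p - g k).
    rewrite -WD; split=> //; exists (p' - p); last by exists (g k).
    by apply: subset_closure; exists p' => //; exists p.
  by move=> /= /eqP; rewrite subr_eq0 subr_eq addrC => /eqP.
(* The intersection on the left does not require [0] to be in [Q], but [nu] is concentrated on the
   cross-section, where [0] is present. *)
have -> : nu (\bigcap_k (closed_act (- g k) @` cross_section Po)) =
    nu (pattern_section Po g).
  have -> : pattern_section Po g =
      (\bigcap_k (closed_act (- g k) @` cross_section Po)) `&` cross_section Po.
    rewrite setIC; apply/seteqP; split=> Q [TQ Qg]; split=> // k _.
      rewrite closed_act_image opprK; apply/(cross_section_actE hG).
      by split; [case: TQ => -[]|exact: Qg].
    have := Qg k I; rewrite closed_act_image opprK.
    by move=> /(cross_section_actE hG)[].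
  have [-> //] := is_transverse_transverse_measure hG hm oU U0 sU mV VU pV mV0 mu_act.
  apply: measurable_closed; apply: closed_bigI => k _; rewrite closed_act_image opprK.
  apply: preimage_closed; last exact: cross_section_closed.
  by move=> Q _; exact: closed_act_continuousr.
apply: cancel_m; rewrite nuE; last by move=> Q [].
apply: (upper_bound hG hm oU U0 sU oW W0 gW mu_act mV pV VU V0 mV0).
exact: (exists_folner hdPo).
Qed.
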